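(* For $1\le i\le k$ define $D_i$ on left $\mathcal A_\hbar[x_1,\dots,x_n]$-linear combinations of the elements $\overline T_\nu$ ($\nu\subseteq(n-k)^k$) by $D_i(g\,\overline T_\mu)=g\,D_i(\overline T_\mu)$ for $g\in\mathcal A_\hbar[x_1,\dots,x_n]$ and $$D_i(\overline T_\mu)=x_{\mu_i+k+1-i}\,\overline T_\mu+\sum_\lambda\bigl(\hbar-(p-q)x_{\mathtt h(\mu/\lambda)}\bigr)p^{\operatorname{ht}(\mu/\lambda)-1}q^{\operatorname{wd}(\mu/\lambda)-1}\,\overline T_\lambda,$$ the sum over $\lambda\subseteq(n-k)^k$ such that $\mu/\lambda$ is a ribbon with head in row $i$. Then for $\mu\subseteq(n-k)^k$ and $0\le r\le k$, in $\widehat H_n$, $$\overline T_\mu\,e_r(x_1,\dots,x_k)=\sum_{1\le i_1<\cdots<i_r\le k}D_{i_1}\bigl(D_{i_2}(\cdots D_{i_r}(\overline T_\mu)\cdots)\bigr).$$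
   Context: $\mathcal A_\hbar=\mathbb Q[p,q,\hbar]$; $\widehat H_n$ is generated by $T_1,\dots,T_{n-1},x_1,\dots,x_n$ with $(T_i+p)(T_i-q)=0$, braid relations, $x_ix_j=x_jx_i$, $T_ix_j=x_jT_i$ ($j\ne i,i+1$), $T_ix_i=x_{i+1}T_i+(\hbar-(p-q)x_i)$, $T_ix_{i+1}=x_iT_i-(\hbar-(p-q)x_i)$. $\overline T_i=T_i+p-q$, $\overline T_w$ via reduced words. For $\nu\subseteq(n-k)^k$, $w_\nu$ is the permutation with $w_\nu(k+1-i)=\nu_i+k+1-i$ ($1\le i\le k$), increasing on $\{k+1,\dots,n\}$. $[m]=(p^m-q^m)/(p-q)$, $[m]!=\prod_{j\le m}[j]$, $d=\binom k2+\binom{n-k}2$, $\Sigma^n_k=\frac1{[k]![n-k]!}\sum_{v\in S_k\times S_{n-k}}q^{d-\ell(v)}\overline T_v$ (scalars extended to invert $[k]![n-k]!$), $\overline T_\nu=\overline T_{w_\nu}\Sigma^n_k$. Ribbon: nonempty connected skew shape $\mu/\lambda$ with no $2\times2$ square; head = top-right box; $\operatorname{ht},\operatorname{wd}$ = numbers of rows, columns; head in row $i$ gives $\mathtt h(\mu/\lambda)=\mu_i+k+1-i$. *)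

(* Defs.v *)
From HB Require Import structures.
From mathcomp Require Import all_boot all_order all_algebra.
From Stdlib Require Import ClassicalEpsilon.
Set Implicit Arguments. Unset Strict Implicit. Unset Printing Implicit Defensive.
Import Order.TTheory GRing.Theory.
Local Open Scope ring_scope.

Definition isb (P : Prop) : bool :=
  if excluded_middle_informative P then true else false.

(* A permutation w of {1..n} is the sequence [:: w(1); ...; w(n)].
   Products of permutations are compositions of functions. *)

(* w s_{j+1} : swap positions j and j+1 (0-based) of the one-line notation *)
Definition swapw (w : seq nat) (j : nat) : seq nat :=
  [seq nth 0%N w (if t == j then j.+1 else if t == j.+1 then j else t)
  | t <- iota 0 (size w)].

(* a reduced word [:: i1; ...; il] with w = s_{i1} ... s_{il} :
   if w has a descent at i, w = (w s_i) s_i with l(w s_i) = l(w) - 1 *)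
Fixpoint rword (fuel : nat) (w : seq nat) : seq nat :=
  if fuel is f.+1 then
    let j := find (fun t => nth 0%N w t.+1 < nth 0%N w t)%N (iota 0 (size w).-1) in
    if (j < (size w).-1)%N then rcons (rword f (swapw w j)) j.+1 else [::]
  else [::].

Definition redword (w : seq nat) : seq nat := rword (size w ^ 2) w.

Definition perm_len (w : seq nat) : nat :=
  (\sum_(i < size w) \sum_(j < size w)
     ((i < j) && (nth 0 w j < nth 0 w i)))%N.

(* nu = [:: nu_1; ...; nu_k], nu_i = nth 0 nu (i-1) *)
Definition in_box (n k : nat) (nu : seq nat) : bool :=
  [&& size nu == k, all (fun a => a <= n - k)%N nu & sorted geq nu].

Fixpoint allseqs (k m : nat) : seq (seq nat) :=
  if k is k'.+1 then [seq a :: s | a <- iota 0 m.+1, s <- allseqs k' m]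
  else [:: [::]].

Definition boxparts (n k : nat) : seq (seq nat) :=
  [seq s <- allseqs k (n - k) | sorted geq s].

(* w_nu : w_nu(k+1-i) = nu_i + k+1-i for 1 <= i <= k, increasing on {k+1..n} *)
Definition wnu (n k : nat) (nu : seq nat) : seq nat :=
  let top := [seq (nth 0 nu (k - a).-1 + a.+1)%N | a <- iota 0 k] in
  top ++ [seq v <- iota 1 n | v \notin top].

(* boxes (row, column) of the skew shape mu/lam, rows 1..k (English convention) *)
Definition skew_cells (k : nat) (mu lam : seq nat) : seq (nat * nat) :=
  [seq (r, c) | r <- iota 1 k,
     c <- iota (nth 0 lam r.-1).+1 (nth 0 mu r.-1 - nth 0 lam r.-1)].

Definition adjacent (a b : nat * nat) : bool :=
  ((a.1 == b.1) && ((a.2 == b.2.+1) || (b.2 == a.2.+1))) ||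
  ((a.2 == b.2) && ((a.1 == b.1.+1) || (b.1 == a.1.+1))).

Definition connected_cells (C : seq (nat * nat)) : Prop :=
  forall S : nat * nat -> Prop,
    (exists c, c \in C /\ S c) ->
    (forall c d, c \in C -> d \in C -> adjacent c d -> S c -> S d) ->
    forall c, c \in C -> S c.

(* mu/lam is a ribbon (nonempty connected skew shape, no 2x2 square)
   whose head (top-right box) lies in row i *)
Definition ribbon_head_row (k : nat) (mu lam : seq nat) (i : nat) : Prop :=
  let C := skew_cells k mu lam in
  [/\ (forall r, nth 0 lam r <= nth 0 mu r)%N,
      C != [::],
      connected_cells C,
      ~ (exists r c, [/\ (r, c) \in C, (r.+1, c) \in C,
                         (r, c.+1) \in C & (r.+1, c.+1) \in C]) &
      (* the head is in the top row of the ribbon *)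
      (exists c, (i, c) \in C) /\ (forall r c, (r, c) \in C -> i <= r)%N].

Definition ribbon_ht (k : nat) (mu lam : seq nat) : nat :=
  size (undup (map fst (skew_cells k mu lam))).
Definition ribbon_wd (k : nat) (mu lam : seq nat) : nat :=
  size (undup (map snd (skew_cells k mu lam))).

Section Hecke.
Variables (H : algType rat) (p q : H).

(* [m] = (p^m - q^m)/(p - q) = sum_{j<m} p^j q^{m-1-j} *)
Definition qint (m : nat) : H := \sum_(j < m) p ^+ j * q ^+ (m.-1 - j).
Definition qfact (m : nat) : H := \prod_(j < m) qint j.+1.

Variables (T : nat -> H).
Definition Tbar (i : nat) : H := T i + (p - q).
Definition Tbw (w : seq nat) : H := \prod_(i <- redword w) Tbar i.

Variables (cinv : H) (n k : nat).
(* cinv is (to be assumed) the inverse of [k]![n-k]! *)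
Definition dd : nat := ('C(k, 2) + 'C(n - k, 2))%N.
Definition Sigma : H :=
  cinv * \sum_(a <- permutations (iota 1 k))
           \sum_(b <- permutations (iota k.+1 (n - k)))
              q ^+ (dd - perm_len (a ++ b)) * Tbw (a ++ b).

Definition Tnu (nu : seq nat) : H := Tbw (wnu n k nu) * Sigma.

Variables (hb : H) (x : nat -> H).

(* left A[x]-combinations of the Tbar_nu: formal lists of (coefficient, nu) *)
Definition Dop (i : nat) (L : seq (H * seq nat)) : seq (H * seq nat) :=
  flatten [seq
    (gm.1 * x (nth 0 gm.2 i.-1 + k.+1 - i)%N, gm.2) ::
    [seq (gm.1 * ((hb - (p - q) * x (nth 0 gm.2 i.-1 + k.+1 - i)%N)
              * p ^+ (ribbon_ht k gm.2 lam).-1 * q ^+ (ribbon_wd k gm.2 lam).-1), lam)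
    | lam <- boxparts n k & isb (ribbon_head_row k gm.2 lam i)]
  | gm <- L].

Definition evalc (L : seq (H * seq nat)) : H := \sum_(gm <- L) gm.1 * Tnu gm.2.

End Hecke.

Fixpoint incr_choose (l : seq nat) (r : nat) : seq (seq nat) :=
  match r, l with
  | 0%N, _ => [:: [::]]
  | _.+1, [::] => [::]
  | r'.+1, a :: l' => [seq a :: s | s <- incr_choose l' r'] ++ incr_choose l' r
  end.

Definition elem_sym (R : pzRingType) (x : nat -> R) (k r : nat) : R :=
  \sum_(s <- incr_choose (iota 1 k) r) \prod_(i <- s) x i.

(* Main.v *)
Require Import Defs.
From HB Require Import structures.
From mathcomp Require Import all_boot all_order all_algebra zify.
From Stdlib Require Import ClassicalEpsilon.
Set Implicit Arguments. Unset Strict Implicit. Unset Printing Implicit Defensive.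
Import GRing.Theory.
Local Open Scope ring_scope.

(** Write t_i = T_i + p - q and c_j = hbar - (p - q) x_j, so that
    t_i x_i = x_(i+1) t_i + c_(i+1) and t_i c_i = c_(i+1) T_i.
    The element w_mu has the reduced word C_k ... C_2 C_1, where row i contributes the
    descending run C_i = s_(a+mu_i-1) ... s_a with a = k+1-i.  Moving x_a leftwards
    through this word leaves it as x_(a+mu_i) or breaks the run C_i at some m < mu_i.
    In the second case the letters left of the break are shifted to indices above k and
    are absorbed by the symmetrizer, each giving a factor q; the remaining product, in
    which row i has length m, is straightened by exchanging it with the longer rows
    below it, each exchange releasing a letter of index below a which is absorbed with a
    factor p.  The result is the ribbon with head in row i and last row of length m, and
    every ribbon arises once.  Only letters of index above k or below a have to be
    absorbed, and these commute with x_b for a < b <= k.  Hence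
    D_(i_1) ... D_(i_r) of the basis element of mu is that element with
    x_(k+1-i_r) ... x_(k+1-i_1) inserted before the symmetrizer, term by term, and
    e_r(x_1, ..., x_k) commutes with the symmetrizer. *)

(** * Reduced words *)

(** Applied to 0-based positions this is s_(j+1); applied to the values of a one-line notation,
    which start at 1, it is s_j. *)
Definition swapn (j t : nat) : nat :=
  if t == j then j.+1 else if t == j.+1 then j else t.

Lemma swapnK j : involutive (swapn j).
Proof. by move=> t; rewrite /swapn; do ?[case: eqP => //=]; lia. Qed.

Lemma swapn_lt j m t : (j.+1 < m)%N -> (swapn j t < m)%N = (t < m)%N.
Proof. by rewrite /swapn; do ?[case: eqP => //=]; lia. Qed.

Lemma size_swapw (w : seq nat) j : size (swapw w j) = size w.
Proof. by rewrite size_map size_iota. Qed.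

Lemma nth_swapw (w : seq nat) j t : (j.+1 < size w)%N ->
  nth 0%N (swapw w j) t = nth 0%N w (swapn j t).
Proof.
move=> hj; case: (ltnP t (size w)) => ht.
  by rewrite (nth_map 0%N) ?size_iota // nth_iota // add0n.
by rewrite !nth_default ?size_swapw // leqNgt swapn_lt // -leqNgt.
Qed.

Lemma swapw_uniq (w : seq nat) j : (j.+1 < size w)%N -> uniq w -> uniq (swapw w j).
Proof.
move=> hj uw; rewrite map_inj_in_uniq ?iota_uniq // => a b.
rewrite !mem_iota !add0n /= => ha hb /eqP.
rewrite nth_uniq ?(swapn_lt _ hj) // => /eqP.
exact: (can_inj (swapnK j)).
Qed.

(** Reindexing both sums by the transposition compares the same pairs of values; only the pair of
    positions j, j+1 changes its contribution. *)
Lemma perm_len_swapw (w : seq nat) j : (j.+1 < size w)%N ->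
  (nth 0 w j.+1 < nth 0 w j)%N -> perm_len w = (perm_len (swapw w j)).+1.
Proof.
move=> hj hd; rewrite /perm_len size_swapw.
set N := size w in hj *.
pose so (i : 'I_N) : 'I_N := Ordinal (etrans (swapn_lt i hj) (ltn_ord i)).
have soK : involutive so by move=> i; apply: val_inj; apply: swapnK.
have -> : (\sum_(i < N) \sum_(j0 < N)
    ((i < j0) && (nth 0 (swapw w j) j0 < nth 0 (swapw w j) i)) =
   \sum_(i < N) \sum_(j0 < N) ((so i < so j0) && (nth 0 w j0 < nth 0 w i)))%N.
  rewrite (reindex_inj (can_inj soK)); apply: eq_bigr => a _.
  rewrite (reindex_inj (can_inj soK)); apply: eq_bigr => b _.
  by rewrite !nth_swapw //= !swapnK.
rewrite !pair_big /=.
pose ja : 'I_N := Ordinal (ltnW hj); pose jb : 'I_N := Ordinal hj.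
rewrite (bigD1 (ja, jb)) //= [in RHS](bigD1 (ja, jb)) //=.
rewrite hd ltnSn /= {1}/swapn eqxx /swapn gtn_eqF // eqxx ltnNge ltnW //= add0n add1n.
congr _.+1; apply: eq_bigr => -[a b] /=; rewrite xpair_eqE -!val_eqE /= => hab.
case: (ltnP (nth 0 w b) (nth 0 w a)) => hw; last by rewrite !andbF.
rewrite !andbT; congr nat_of_bool.
(* The pair (j+1, j) is excluded by the descent; every other remaining pair is ordered alike before
   and after the transposition. *)
have hab' : ~~ ((val a == j.+1) && (val b == j)).
  by apply/negP => /andP[/eqP ea /eqP eb]; move: hw hd; rewrite ea eb => h1 h2; have := ltn_trans h1 h2; rewrite ltnn.
move: hab hab' => /=; do ?[case: eqP => //=]; lia.
Qed.

Lemma perm_len_max (w : seq nat) : (perm_len w <= size w ^ 2)%N.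
Proof.
rewrite /perm_len; apply: (@leq_trans (\sum_(i < size w) \sum_(j < size w) 1)%N).
  by apply: leq_sum => i _; apply: leq_sum => j _; case: (_ && _).
under eq_bigr do rewrite sum_nat_const card_ord muln1.
by rewrite sum_nat_const card_ord mulnn.
Qed.

Definition first_descent (w : seq nat) : nat :=
  find (fun t => nth 0%N w t.+1 < nth 0%N w t)%N (iota 0 (size w).-1).

Lemma first_descentP (w : seq nat) j : (j.+1 < size w)%N -> (nth 0 w j.+1 < nth 0 w j)%N ->
  [/\ (first_descent w).+1 < size w, first_descent w <= j &
      nth 0 w (first_descent w).+1 < nth 0 w (first_descent w)]%N.
Proof.
move=> hj hd.
have hle : (first_descent w <= j)%N.
  rewrite leqNgt; apply/negP => /(before_find 0%N).
  by rewrite nth_iota ?add0n ?hd //; lia.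
have hhas : has (fun t => nth 0%N w t.+1 < nth 0%N w t)%N (iota 0 (size w).-1).
  apply/hasP; exists j => //; rewrite mem_iota; lia.
have := nth_find 0%N hhas; rewrite -/(first_descent w) nth_iota ?add0n; last by lia.
by split => //; lia.
Qed.

Lemma rwordS f (w : seq nat) : rword f.+1 w =
  if (first_descent w < (size w).-1)%N
  then rcons (rword f (swapw w (first_descent w))) (first_descent w).+1 else [::].
Proof. by []. Qed.

Lemma first_descent_lt (w : seq nat) : (first_descent w < (size w).-1)%N ->
  (nth 0 w (first_descent w).+1 < nth 0 w (first_descent w))%N.
Proof.
move=> h; have hh : has (fun t => nth 0%N w t.+1 < nth 0%N w t)%N (iota 0 (size w).-1).
  by rewrite has_find size_iota.
by have := nth_find 0%N hh; rewrite -/(first_descent w) nth_iota ?add0n.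
Qed.

(** Each letter removes one inversion, so fuel at least the number of inversions lets the recursion
    finish. *)
Lemma rword_fuel f f' (w : seq nat) : (perm_len w <= f)%N -> (perm_len w <= f')%N ->
  rword f w = rword f' w.
Proof.
elim: f f' w => [|f IH] [|f'] w // h h'; rewrite !rwordS //.
- case: ifP => // hf; have := perm_len_swapw _ (first_descent_lt hf); lia.
- case: ifP => // hf; have := perm_len_swapw _ (first_descent_lt hf); lia.
case: ifP => // hf; have := perm_len_swapw _ (first_descent_lt hf) => hp.
by congr rcons; apply: IH; lia.
Qed.

Lemma redword_rcons (w : seq nat) j : (j.+1 < size w)%N -> (nth 0 w j.+1 < nth 0 w j)%N ->
  redword w = rcons (redword (swapw w (first_descent w))) (first_descent w).+1.
Proof.
move=> hj hd; have [h1 h2 h3] := first_descentP hj hd.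
have hp := perm_len_swapw h1 h3; have hm := perm_len_max w.
rewrite /redword size_swapw.
have -> : (size w ^ 2 = (size w ^ 2).-1.+1)%N by lia.
rewrite rwordS ifT; last by lia.
by congr rcons; apply: rword_fuel; lia.
Qed.

Lemma redword_sorted (w : seq nat) : (forall j, (j.+1 < size w)%N -> (nth 0 w j <= nth 0 w j.+1)%N) ->
  redword w = [::].
Proof.
move=> h; rewrite /redword; case: (size w ^ 2)%N => // f.
rewrite rwordS; case: ifP => // hf; have := first_descent_lt hf.
by have := h (first_descent w); lia.
Qed.

Lemma mem_redword (w : seq nat) l : l \in redword w -> (1 <= l < size w)%N.
Proof.
rewrite /redword; move: (size w ^ 2)%N => f; elim: f w => // f IH w.
rewrite rwordS; case: ifP => // hf; rewrite mem_rcons in_cons => /orP[/eqP->|].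
  by lia.
by move=> /IH; rewrite size_swapw.
Qed.

(** No descent straddles position k, and a swap inside one block keeps the values of the first block
    below those of the second. *)
Lemma redword_block (w : seq nat) l k :
  (forall s t, s < k -> k <= t < size w -> nth 0 w s < nth 0 w t)%N ->
  l \in redword w -> l != k.
Proof.
rewrite /redword; move: (size w ^ 2)%N => f; elim: f w => // f IH w hw.
rewrite rwordS; case: ifP => // hf; have hd := first_descent_lt hf.
have hk : (first_descent w).+1 != k.
  by apply/eqP => hk; have := hw (first_descent w) (first_descent w).+1; lia.
rewrite mem_rcons in_cons => /orP[/eqP->|] //.
apply: IH => s t hs ht; rewrite size_swapw in ht.
by rewrite !nth_swapw; [apply: hw; rewrite /swapn; do ?[case: eqP => //=]; lia|lia|lia].
Qed.

Section Reduced.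
Variables (A : pzRingType) (n : nat) (t : nat -> A).
Hypothesis tbraid : forall i, (1 <= i)%N -> (i.+1 < n)%N ->
  t i * t i.+1 * t i = t i.+1 * t i * t i.+1.
Hypothesis tfar : forall i j, (1 <= i)%N -> (j < n)%N -> (i.+1 < j)%N ->
  t i * t j = t j * t i.

Definition prod_red (w : seq nat) : A := \prod_(i <- redword w) t i.

Lemma swapwC (w : seq nat) i j : (i.+1 < j)%N -> (j.+1 < size w)%N ->
  swapw (swapw w i) j = swapw (swapw w j) i.
Proof.
move=> hij hj; apply: (eq_from_nth (x0 := 0%N)); rewrite ?size_swapw // => s _.
rewrite !nth_swapw ?size_swapw //; try lia.
by congr nth; rewrite /swapn; do ?[case: eqP => //=]; lia.
Qed.

Lemma swapw_braid (w : seq nat) i : (i.+2 < size w)%N ->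
  swapw (swapw (swapw w i) i.+1) i = swapw (swapw (swapw w i.+1) i) i.+1.
Proof.
move=> hj; apply: (eq_from_nth (x0 := 0%N)); rewrite ?size_swapw // => s _.
rewrite !nth_swapw ?size_swapw //; try lia.
by congr nth; rewrite /swapn; do ?[case: eqP => //=]; lia.
Qed.

(** The instance of Matsumoto's theorem that is needed: any descent may be peeled off, not only the
    first one. By induction on length, the first descent d and the given j are compared through a
    permutation lying below both. *)
Lemma prod_red_swapw (w : seq nat) j : (size w <= n)%N -> uniq w -> (j.+1 < size w)%N ->
  (nth 0 w j.+1 < nth 0 w j)%N -> prod_red w = prod_red (swapw w j) * t j.+1.
Proof.
have [N] := ubnP (perm_len w); elim: N w j => // N IH w j hN hn uw hj hd.
have [h1 h2 h3] := first_descentP hj hd.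
have E : prod_red w = prod_red (swapw w (first_descent w)) * t (first_descent w).+1.
  by rewrite /prod_red (redword_rcons hj hd) -cats1 big_cat big_seq1.
have [d hd1 {h2 h3}] : exists2 d, first_descent w = d & (d <= j)%N /\ (nth 0 w d.+1 < nth 0 w d)%N.
  by exists (first_descent w).
rewrite {}hd1 in h1 E *; case=> h2 h3.
have hp1 := perm_len_swapw h1 h3; have hp2 := perm_len_swapw hj hd.
have u1 := swapw_uniq h1 uw; have u2 := swapw_uniq hj uw.
case: (ltngtP d j) h2 => // [hdj _|ed _]; last by rewrite -ed E.
have [hlt|hge] := ltnP d.+1 j.
  have e1 : prod_red (swapw w d) = prod_red (swapw (swapw w d) j) * t j.+1.
    apply: IH; rewrite ?size_swapw //; first by lia.
    by rewrite !nth_swapw // /swapn; do ?[case: eqP => //=]; lia.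
  have e2 : prod_red (swapw w j) = prod_red (swapw (swapw w j) d) * t d.+1.
    apply: IH; rewrite ?size_swapw //; first by lia.
    by rewrite !nth_swapw // /swapn; do ?[case: eqP => //=]; lia.
  by rewrite E e1 e2 swapwC // -!mulrA (@tfar d.+1 j.+1) //; lia.
(* Adjacent descents: w decreases at d, d+1, d+2, so three swaps in either order lead to the same
   permutation and the two words differ by a braid move. *)
have ej : j = d.+1 by lia.
subst j.
have e1 : prod_red (swapw w d) = prod_red (swapw (swapw w d) d.+1) * t d.+2.
  apply: IH; rewrite ?size_swapw //; first by lia.
  by rewrite !nth_swapw // /swapn; do ?[case: eqP => //=]; lia.
have hA : (nth 0 (swapw w d) d.+2 < nth 0 (swapw w d) d.+1)%N.
  by rewrite !nth_swapw // /swapn; do ?[case: eqP => //=]; lia.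
have hB : (nth 0 (swapw w d.+1) d.+1 < nth 0 (swapw w d.+1) d)%N.
  by rewrite !nth_swapw // /swapn; do ?[case: eqP => //=]; lia.
have hp3 : perm_len (swapw w d) = (perm_len (swapw (swapw w d) d.+1)).+1.
  by apply: perm_len_swapw; rewrite ?size_swapw.
have hp4 : perm_len (swapw w d.+1) = (perm_len (swapw (swapw w d.+1) d)).+1.
  by apply: perm_len_swapw; rewrite ?size_swapw.
have u3 : uniq (swapw (swapw w d) d.+1) by apply: swapw_uniq; rewrite ?size_swapw.
have u4 : uniq (swapw (swapw w d.+1) d) by apply: swapw_uniq; rewrite ?size_swapw.
have e2 : prod_red (swapw w d.+1) = prod_red (swapw (swapw w d.+1) d) * t d.+1.
  by apply: IH; rewrite ?size_swapw //; lia.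
have e3 : prod_red (swapw (swapw w d) d.+1) = prod_red (swapw (swapw (swapw w d) d.+1) d) * t d.+1.
  apply: IH; rewrite ?size_swapw //; first by lia.
  by rewrite !nth_swapw ?size_swapw // /swapn; do ?[case: eqP => //=]; lia.
have e4 : prod_red (swapw (swapw w d.+1) d) = prod_red (swapw (swapw (swapw w d.+1) d) d.+1) * t d.+2.
  apply: IH; rewrite ?size_swapw //; first by lia.
  by rewrite !nth_swapw ?size_swapw // /swapn; do ?[case: eqP => //=]; lia.
rewrite E e1 e2 e3 e4 swapw_braid // -!mulrA; congr (_ * _).
by rewrite !mulrA tbraid //; lia.
Qed.

Lemma perm_swapw (w : seq nat) j : (j.+1 < size w)%N -> uniq w -> perm_eq (swapw w j) w.
Proof.
move=> hj uw; apply: uniq_perm => //; first exact: swapw_uniq.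
have sub : {subset swapw w j <= w}; last first.
  by have [] := uniq_min_size (swapw_uniq hj uw) sub _; rewrite ?size_swapw.
move=> v /mapP[u]; rewrite mem_iota add0n => hu ->.
by apply: mem_nth; rewrite (swapn_lt u hj).
Qed.

Lemma nth_map_swapn (w : seq nat) l s : (s < size w)%N -> nth 0%N (map (swapn l) w) s = swapn l (nth 0%N w s).
Proof. exact: nth_map. Qed.

Lemma map_swapn_swapw (w : seq nat) l j : (j.+1 < size w)%N ->
  map (swapn l) (swapw w j) = swapw (map (swapn l) w) j.
Proof.
move=> hj; apply: (eq_from_nth (x0 := 0%N)); rewrite ?size_swapw ?size_map ?size_iota // => s hs.
by rewrite nth_swapw ?size_map // nth_map_swapn ?size_swapw // nth_swapw // nth_map_swapn // swapn_lt.
Qed.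

(* [map (swapn l) w] is s_l w.  When l precedes l+1 in w, every right descent of w
   is one of s_l w, so descents can be peeled off both on the right. *)
Lemma prod_red_swap_values (w : seq nat) l a b : (size w <= n)%N -> perm_eq w (iota 1 (size w)) ->
  (a < b < size w)%N -> nth 0%N w a = l -> nth 0%N w b = l.+1 ->
  perm_len (map (swapn l) w) = (perm_len w).+1 /\ prod_red (map (swapn l) w) = t l * prod_red w.
Proof.
have [N] := ubnP (perm_len w); elim: N w a b => // N IH w a b hN hn pw hab ha hb.
have uw : uniq w by rewrite (perm_uniq pw) iota_uniq.
have uw' : uniq (map (swapn l) w) by rewrite map_inj_uniq //; apply: (can_inj (swapnK l)).
have eqn s u : (s < size w)%N -> (u < size w)%N -> nth 0%N w s = nth 0%N w u -> s = u.
  by move=> h1 h2 /eqP; rewrite nth_uniq // => /eqP.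
have [hf|hf] := boolP (first_descent w < (size w).-1)%N; last first.
  (* Without descents w is the identity, and s_l w is the single letter s_l. *)
  have hw : w = iota 1 (size w).
    apply: (sorted_eq leq_trans anti_leq) => //; last exact: iota_sorted.
    apply/(sortedP 0%N) => j hj; rewrite leqNgt; apply/negP => hd.
    by have [h1 _ _] := first_descentP hj hd; lia.
  have nw s : (s < size w)%N -> nth 0%N w s = s.+1.
    by move=> hs; rewrite {1}hw nth_iota // add1n.
  have := nw a; have := nw b; rewrite ha hb => h1 h2.
  have {h1 h2 ha hb} [ea eb] : l = a.+1 /\ b = a.+1 by lia.
  rewrite {}ea {}eb in hab uw' *.
  have h1 : (nth 0 (map (swapn a.+1) w) a.+1 < nth 0 (map (swapn a.+1) w) a)%N.
    by rewrite !nth_map_swapn ?nw /swapn; do ?[case: eqP => //=]; lia.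
  have h2 : (a.+1 < size (map (swapn a.+1) w))%N by rewrite size_map; lia.
  have h3 : swapw (map (swapn a.+1) w) a = w.
    apply: (eq_from_nth (x0 := 0%N)); rewrite ?size_swapw ?size_map // => s hs.
    rewrite nth_swapw // nth_map_swapn; last by rewrite swapn_lt //; lia.
    by rewrite !nw ?swapn_lt //; [rewrite /swapn; do ?[case: eqP => //=]; lia|lia].
  split; first by rewrite (perm_len_swapw h2 h1) h3.
  rewrite (prod_red_swapw _ uw' h2 h1) ?size_map // h3 /prod_red redword_sorted.
    by rewrite big_nil mulr1 mul1r.
  by move=> j hj; rewrite !nw; lia.
have hd := first_descent_lt hf; have hj : ((first_descent w).+1 < size w)%N by lia.
move: (first_descent w) hd hj {hf} => j hd hj.
have hd' : (nth 0 (map (swapn l) w) j.+1 < nth 0 (map (swapn l) w) j)%N.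
  (* Exchanging the values l and l+1 can undo a descent only if these two values form it, and then
     l+1 would precede l. *)
  have aux : ~ (nth 0%N w j = l.+1 /\ nth 0%N w j.+1 = l).
    move=> [h1 h2]; have := eqn j b; have := eqn j.+1 a.
    by rewrite h1 h2 ha hb => g1 g2; lia.
  by rewrite !nth_map_swapn /swapn; do ?[case: eqP => //=]; lia.
have hj' : (j.+1 < size (map (swapn l) w))%N by rewrite size_map.
have hp := perm_len_swapw hj hd.
have hp' := perm_len_swapw hj' hd'.
have [||||||IH1 IH2] := IH (swapw w j) (swapn j a) (swapn j b); rewrite ?size_swapw //.
- by lia.
- exact: perm_trans (perm_swapw hj uw) pw.
- have aux : ~ (a = j /\ b = j.+1) by move=> [ea eb]; subst; lia.
  by rewrite /swapn; do ?[case: eqP => //=]; lia.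
- by rewrite nth_swapw // swapnK.
- by rewrite nth_swapw // swapnK.
rewrite map_swapn_swapw // in IH1 IH2.
split; first by rewrite hp' IH1 -hp.
by rewrite (prod_red_swapw _ uw' hj' hd') ?size_map // IH2 -mulrA -(prod_red_swapw hn uw hj hd).
Qed.
End Reduced.

(** * Products of descending runs *)

(** Removing a ribbon changes the rows in this way: each row longer than m moves up one place and
    loses a box, and m fills the place left by the last of them. *)
Fixpoint insert_row (m : nat) (s : seq nat) : seq nat :=
  if s is c :: s' then
    if (m < c)%N then c.-1 :: insert_row m s' else m :: s
  else [:: m].

Lemma size_insert_row m s : size (insert_row m s) = (size s).+1.
Proof. by elim: s => //= c s IH; case: ifP => //= _; rewrite IH. Qed.

Section Affine.
Variables (A : pzRingType) (n : nat) (p q hb : A) (t x : nat -> A).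
Hypothesis pC : forall y, p * y = y * p.
Hypothesis qC : forall y, q * y = y * q.
Hypothesis hC : forall y, hb * y = y * hb.
Hypothesis tbraid : forall i, (1 <= i)%N -> (i.+1 < n)%N ->
  t i * t i.+1 * t i = t i.+1 * t i * t i.+1.
Hypothesis tfar : forall i j, (1 <= i)%N -> (j < n)%N -> (i.+1 < j)%N ->
  t i * t j = t j * t i.
Let cx (j : nat) : A := hb - (p - q) * x j.
Hypothesis tx : forall i j, (1 <= i < n)%N -> (1 <= j <= n)%N ->
  j != i -> j != i.+1 -> t i * x j = x j * t i.
Hypothesis txi : forall i, (1 <= i < n)%N -> t i * x i = x i.+1 * t i + cx i.+1.

Lemma pXC i y : p ^+ i * y = y * p ^+ i.
Proof. by apply/commr_sym/commrX => //; apply/commr_sym/pC. Qed.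

Lemma mulpC y z : y * (p * z) = p * (y * z).
Proof. by rewrite mulrA -pC mulrA. Qed.

Lemma qXC i y : q ^+ i * y = y * q ^+ i.
Proof. by apply/commr_sym/commrX => //; apply/commr_sym/qC. Qed.

Lemma comm_cx y j : y * x j = x j * y -> y * cx j = cx j * y.
Proof.
move=> h; apply: commrB; first exact/commr_sym/hC.
by apply: commrM => //; apply: commrB; apply/commr_sym; [apply: pC|apply: qC].
Qed.

Lemma t_cx i : (1 <= i < n)%N -> t i * cx i = cx i.+1 * (t i - (p - q)).
Proof.
move=> hi; have pqC y : (p - q) * y = y * (p - q).
  by rewrite mulrBl mulrBr pC qC.
rewrite [LHS]mulrBr mulrA -pqC -[X in _ - X]mulrA txi // [RHS]mulrBr.
rewrite (mulrDr (p - q)) opprD addrA (pqC (cx i.+1)); congr (_ - _).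
by rewrite -(hC (t i)) mulrA -mulrBl.
Qed.

(** With a = k+1-i and m = mu_i this is the descending run C_i in the letters t. *)
Fixpoint run (a m : nat) : A := if m is m'.+1 then t (a + m') * run a m' else 1.

(** [rows 0 mu] is C_k ... C_1. The shift b is the number of rows lying below those of u, so that a
    partition can be split by [rows_cat]. *)
Fixpoint rows (b : nat) (u : seq nat) : A :=
  if u is c :: u' then rows b u' * run (b + size u').+1 c else 1.

Lemma run_comm y a m :
  (forall l, (a <= l < a + m)%N -> y * t l = t l * y) ->
  y * run a m = run a m * y.
Proof.
elim: m => [|m IH] h /=; first by rewrite mulr1 mul1r.
rewrite mulrA h; last by lia.
by rewrite -mulrA IH ?mulrA // => l hl; apply: h; lia.
Qed.

Lemma rows_comm y b u M : all (fun c => c <= M)%N u ->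
  (forall l, (b < l < b + size u + M)%N -> y * t l = t l * y) ->
  y * rows b u = rows b u * y.
Proof.
elim: u => [|c u IH] /= => [_ _|/andP[hc hu] h]; first by rewrite mulr1 mul1r.
rewrite mulrA IH //; last by move=> l hl; apply: h; lia.
rewrite -!mulrA; congr (_ * _); apply: run_comm => l hl; apply: h; lia.
Qed.

Lemma rows_cat b u s : rows b (u ++ s) = rows b s * rows (b + size s) u.
Proof.
elim: u => [|c u IH] /=; first by rewrite mulr1.
by rewrite IH mulrA size_cat -!addnA (addnC (size u)).
Qed.

(** The letters above l+1 commute with t_l; at l+1, l a braid move turns t_l into t_(l+1), which
    commutes with the lower letters. *)
Lemma t_run b m l : (1 <= b)%N -> (b <= l)%N -> (l.+1 < b + m)%N -> (b + m <= n)%N ->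
  t l * run b m = run b m * t l.+1.
Proof.
move=> hb1; elim: m l => [|m IH] l hl h1 h2 /=; first by lia.
have [hlt|hge] := ltnP l.+1 (b + m).
  by rewrite mulrA tfar ?[LHS]mulrA -?mulrA ?IH //; lia.
case: m IH h1 h2 hge => [|m] IH h1 h2 hge /=; first by lia.
have -> : l = (b + m)%N by lia.
rewrite addnS !mulrA tbraid -?mulrA; try lia.
congr (_ * (_ * _)); apply: run_comm => r hr.
by rewrite -tfar //; lia.
Qed.

Lemma run_recr b m : run b m.+1 = run b.+1 m * t b.
Proof.
elim: m => [|m IH]; first by rewrite /= addn0 mulr1 mul1r.
by rewrite -[LHS]/(t (b + m.+1) * run b m.+1) IH mulrA /= addSnnS.
Qed.

(** By [t_run] each letter of the shorter run passes leftwards through the longer one, its index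
    dropping by one. *)
Lemma run_exchange b c m : (1 <= b)%N -> (m < c)%N -> (b + c <= n)%N ->
  run b c * run b.+1 m = run b m * run b c.
Proof.
move=> hb1 hm hn; elim: m hm => [|m IH] hm /=; first by rewrite mulr1 mul1r.
by rewrite mulrA addSn -t_run -?mulrA ?IH //; lia.
Qed.

(** The j-th term comes from breaking the run at t_(a+j). Each letter t_l further left carries c_l
    to c_(l+1) and becomes t_l - (p - q), which commutes with the remaining run and acts on W by p -
    (p - q) = q. *)
Lemma run_mulx a m W : (1 <= a)%N -> (a + m <= n)%N ->
  (forall l, (a < l < a + m)%N -> t l * W = p * W) ->
  run a m * (x a * W) = x (a + m)%N * (run a m * W) +
    \sum_(j < m) cx (a + m) * (q ^+ (m - j).-1 * (run a j * W)).
Proof.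
move=> ha; elim: m => [|m IH] hm hW /=.
  by rewrite addn0 big_ord0 addr0 !mul1r.
rewrite -mulrA IH; [|lia|by move=> l hl; apply: hW; lia].
rewrite mulrDr mulrA txi; last by lia.
rewrite addnS mulrDl -!mulrA -addrA; congr (_ + _).
(* The new term j = m breaks the run at its leftmost letter. *)
rewrite big_ord_recr /= addrC subSnn expr0 mul1r; congr (_ + _).
rewrite mulr_sumr; apply: eq_bigr => j _.
rewrite mulrA t_cx; last by have := ltn_ord j; lia.
rewrite -mulrA; congr (_ * _).
have -> : (m.+1 - j).-1 = (m - j).-1.+1 by have := ltn_ord j; lia.
rewrite mulrA -qXC exprSr -!mulrA; congr (_ * _).
rewrite mulrA mulrBl run_comm; last first.
  by move=> l hl; rewrite -tfar //; have := ltn_ord j; lia.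
have E : (p - q) * run a j = run a j * (p - q) by rewrite mulrBl mulrBr pC qC.
rewrite E -mulrBr -mulrA mulrBl hW; last by have := ltn_ord j; lia.
by rewrite mulrBl opprB addrC subrK !mulrA qC.
Qed.

Arguments run : simpl never.

Lemma count_geq m c s : path geq c s -> (c <= m)%N -> count (fun c => m < c)%N s = 0%N.
Proof.
move=> hs hc; apply/eqP; rewrite -leqn0 leqNgt -has_count -all_predC.
have /allP hm := order_path_min (rev_trans leq_trans) hs.
by apply/allP => d /hm /= hd; lia.
Qed.

(* Moving a short run past a longer one leaves one letter behind, which acts on Z by p. *)
Lemma rows_insert s m M Z : sorted geq s -> all (fun c => c <= M)%N s -> (size s + M <= n)%N ->
  (forall l, (1 <= l <= size s)%N -> t l * Z = p * Z) ->
  rows 0 s * (run (size s).+1 m * Z) = p ^+ count (fun c => m < c)%N s * (rows 0 (insert_row m s) * Z).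
Proof.
elim: s Z => [|c s IH] Z /=; first by move=> _ _ _ _; rewrite expr0 !mul1r.
move=> ps /andP[hc hs] hn hZ; case: ifP => hm; last first.
  by rewrite (count_geq ps) ?expr0 ?mul1r /= ?add0n -?mulrA //; lia.
case: c ps hc hm => // c ps hc hm; rewrite add0n /= size_insert_row -[in LHS]mulrA.
rewrite [X in _ * X]mulrA run_exchange //; last by lia.
(* The lowest letter of the longer run is the one released onto Z; what is left of that run is the
   shortened row, one place higher. *)
rewrite run_recr -!mulrA hZ; last by lia.
rewrite add1n exprS -!mulrA !mulpC; congr (_ * _).
rewrite add0n IH ?(path_sorted ps) //; first by lia.
(* The shortened row has letters above [size s + 1] only, so it commutes with every t_l that the
   rows of s may release. *)
move=> l hl; rewrite mulrA run_comm -?mulrA ?hZ ?mulpC //; first by lia.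
by move=> r hr; rewrite tfar //; lia.
Qed.

(** Each row of u raises the index by one, by [t_run]. In [rows_mulx] this sends letters of the head
    row other than t_a to indices above k, where Z absorbs them. *)
Lemma t_rows a c u l : (1 <= a)%N -> all (fun d => c <= d)%N u ->
  all (fun d => a + size u + d <= n)%N u ->
  (a < l < a + c)%N -> t l * rows a u = rows a u * t (l + size u)%N.
Proof.
move=> ha; elim: u => [|d u IH] /=; first by rewrite addn0 mulr1 mul1r.
move=> /andP[hd hu] /andP[hdn hn] hl.
rewrite mulrA IH //; last by apply: sub_all hn => e; lia.
by rewrite -!mulrA t_run ?addnS //; lia.
Qed.

(** Here c is the head row, u the rows above it and s those below. The variable passes u unchanged,
    [run_mulx] breaks the run of c, and [rows_insert] straightens each broken product. *)
Lemma rows_mulx u c s Z : let k := (size u + (size s).+1)%N in let a := (size s).+1 in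
  (k <= n)%N -> sorted geq (u ++ c :: s) -> all (fun c => c <= n - k)%N (u ++ c :: s) ->
  (forall l, (1 <= l < a)%N || (k < l < n)%N -> t l * Z = p * Z) ->
  rows 0 (u ++ c :: s) * (x a * Z) = x (a + c)%N * (rows 0 (u ++ c :: s) * Z) +
   \sum_(m < c) cx (a + c) * p ^+ count (fun c => m < c)%N s * q ^+ (c - m).-1 *
      (rows 0 (u ++ insert_row m s) * Z).
Proof.
move=> k a hk hsort; rewrite all_cat => /andP[hu /= /andP[hc hs]] hZ.
have hucs : all (fun d => c <= d)%N u.
  move: hsort; rewrite (sorted_pairwise (rev_trans leq_trans)) pairwise_cat.
  by case/andP => /allrelP h _; apply/allP => d hd; apply: (h d c) => //; rewrite mem_head.
have hss : path geq c s.
  by case: (cat_sorted2 hsort).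
rewrite !rows_cat /= add0n -/a.
pose W := rows a u * Z.
have xW : rows a u * (x a * Z) = x a * W.
  rewrite mulrA -(@rows_comm (x a) a u (n - k)) -?mulrA // => l hl.
  by rewrite tx //; lia.
rewrite -!mulrA xW -/W.
have tW l : (a < l < a + c)%N -> t l * W = p * W.
  move=> hl; rewrite /W mulrA (@t_rows a c) //; last by apply: sub_all hu => d; lia.
  by rewrite -mulrA hZ ?mulpC //; lia.
rewrite run_mulx //; last by lia.
(* The rows below have letters less than [size s + c], too small to interact with x_(a+c). *)
have comm y : (forall l, (0 < l < size s + c)%N -> y * t l = t l * y) ->
    rows 0 s * y = y * rows 0 s.
  move=> hy; rewrite -(@rows_comm y 0 s c) //.
  exact: order_path_min (rev_trans leq_trans) hss.
have commx : rows 0 s * x (a + c) = x (a + c)%N * rows 0 s.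
  by apply: comm => l hl; rewrite tx //; lia.
have commc : rows 0 s * cx (a + c) = cx (a + c) * rows 0 s.
  by apply: comm_cx; apply: commx.
rewrite mulrDr mulrA commx -!mulrA; congr (_ + _).
rewrite mulr_sumr; apply: eq_bigr => m _.
rewrite rows_cat size_insert_row add0n -/a -!mulrA -/W.
rewrite mulrA commc -!mulrA; congr (_ * _).
rewrite mulrA -qXC -mulrA (@rows_insert s m (n - k)) //.
- by rewrite !mulrA -pXC.
- exact: path_sorted hss.
- by lia.
move=> l hl; rewrite /W mulrA (@rows_comm (t l) a u (n - k)) // -?mulrA ?hZ ?mulpC //.
  by lia.
by move=> r hr; rewrite tfar //; lia.
Qed.

End Affine.

(** * Ribbons *)

Lemma isbP P : reflect P (isb P).
Proof. by rewrite /isb; case: excluded_middle_informative => h; constructor. Qed.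

Lemma nth_geq (s : seq nat) a b : sorted geq s -> (a <= b)%N ->
  (nth 0 s b <= nth 0 s a)%N.
Proof.
move=> hs hab; have [hb|hb] := ltnP b (size s); last by rewrite nth_default.
by apply: (sorted_leq_nth (rev_trans leq_trans) leqnn 0%N hs) => //; rewrite inE; lia.
Qed.

Lemma nth_geqP (s : seq nat) : (forall R, nth 0 s R.+1 <= nth 0 s R)%N -> sorted geq s.
Proof. by move=> h; apply/(sortedP 0%N) => R _; apply: h. Qed.

Lemma lt_count_geq (s : seq nat) m r : sorted geq s ->
  (r < count (fun c => m < c)%N s)%N = (m < nth 0 s r)%N.
Proof.
elim: s r => [|c s IH] r hs; first by rewrite nth_nil.
rewrite /=; have [hm|hm] := ltnP m c.
  by case: r => [|r] //=; rewrite add1n ltnS IH // (path_sorted hs).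
rewrite (count_geq hs hm); have := nth_geq hs (leq0n r); rewrite /= => h.
by apply/esym/negbTE; rewrite -leqNgt (leq_trans h hm).
Qed.

Lemma nth_insert_row (s : seq nat) m r : sorted geq s -> nth 0%N (insert_row m s) r =
  let h := count (fun c => m < c)%N s in
  if (r < h)%N then (nth 0 s r).-1%N else if r == h then m else nth 0%N s r.-1.
Proof.
elim: s r => [|c s IH] r hs /=.
  by case: r => [|r] //=; rewrite !nth_nil.
have [hm|hm] := ltnP m c.
  case: r => [|r] //=; rewrite add1n ltnS eqSS IH ?(path_sorted hs) //=.
  by case: r => [|r] //=; case: ltngtP.
by rewrite (count_geq hs hm) addn0 ltn0; case: r => [|[|r]].
Qed.

(** The index produced by [rows_mulx] when the run of row i, counted from 0, is broken at length
    m. *)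
Definition ribbon_removed (mu : seq nat) (i m : nat) : seq nat := take i mu ++ insert_row m (drop i.+1 mu).

Lemma size_ribbon_removed mu i m : (i < size mu)%N -> size (ribbon_removed mu i m) = size mu.
Proof. by move=> hi; rewrite size_cat size_take size_insert_row size_drop hi; lia. Qed.

(* Rows are counted from 0; H is the bottom row of the ribbon and m the part of lam in that row. *)
Definition ribbon_shape (mu lam : seq nat) (i m H : nat) : Prop :=
  [/\ (i <= H)%N, (m < nth 0 mu H)%N,
      (forall R, H < R -> nth 0 mu R <= m)%N, nth 0%N lam H = m &
      (forall R, (R < i)%N \/ (H < R)%N -> nth 0%N lam R = nth 0%N mu R) /\
      (forall R, (i <= R < H)%N -> (nth 0%N lam R).+1 = nth 0%N mu R.+1)].

Lemma ribbon_removedP mu i m : sorted geq mu -> (i < size mu)%N -> (m < nth 0 mu i)%N ->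
  ribbon_shape mu (ribbon_removed mu i m) i m (i + count (fun c => m < c)%N (drop i.+1 mu)).
Proof.
move=> hs hi hm; have hd : sorted geq (drop i.+1 mu).
  by rewrite drop_sorted.
set h := count _ _.
have hh r : (r < h)%N = (m < nth 0 mu (i.+1 + r))%N by rewrite lt_count_geq // nth_drop.
have hr R : nth 0%N (ribbon_removed mu i m) R = if (R < i)%N then nth 0%N mu R else
    if (R < i + h)%N then (nth 0 mu R.+1).-1%N else if R == (i + h)%N then m else nth 0%N mu R.
  rewrite nth_cat size_take hi; case: ltnP => hR; first by rewrite nth_take.
  rewrite nth_insert_row //= -/h !nth_drop ltn_subLR //.
  have -> : (i.+1 + (R - i) = R.+1)%N by lia.
  have -> : ((R - i == h) = (R == i + h))%N by lia.
  case: ltnP => // hRh; case: eqP => // hne.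
  by congr nth; lia.
split; first by lia.
- case: (h) (hh) => [|h'] hh'; first by rewrite addn0.
  by have := hh' h'; rewrite addnS addSn ltnSn => <-.
- by move=> R hR; have := hh (R - i.+1)%N; rewrite subnKC; lia.
- by rewrite hr ltnn eqxx ifF //; lia.
split=> R hR; rewrite hr.
  case: hR => hR; first by rewrite hR.
  by rewrite !ifF //; lia.
rewrite ifF ?ifT; [|lia|lia].
by have := hh (R - i)%N; rewrite (_ : (i.+1 + (R - i) = R.+1)%N); lia.
Qed.

Lemma ribbon_shape_uniq mu lam lam' i m H H' : ribbon_shape mu lam i m H -> ribbon_shape mu lam' i m H' ->
  size lam = size lam' -> lam = lam'.
Proof.
move=> [h1 h2 h3 h4 [h5 h6]] [g1 g2 g3 g4 [g5 g6]] hsz.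
(* Both are the last row of mu longer than m. *)
have e : H = H'.
  have a1 := h3 H'; have a2 := g3 H; lia.
subst H'; apply: (eq_from_nth (x0 := 0%N)) => // R _.
have [hR|hR] := ltnP R i; first by rewrite h5 ?g5; auto.
have [hR'|hR'] := ltnP H R; first by rewrite h5 ?g5; auto.
have [e|hne] := eqVneq R H; first by rewrite e h4 g4.
by have := h6 R; have := g6 R; lia.
Qed.

Lemma mem_skew_cells k mu lam r c : ((r, c) \in skew_cells k mu lam) =
  (1 <= r <= k)%N && (nth 0 lam r.-1 < c <= nth 0 mu r.-1)%N.
Proof.
(* [skew_cells] takes its default entry to be the zero of nat as a ring. *)
rewrite [skew_cells _ _ _]/([seq (r, c) | r <- iota 1 k,
  c <- iota (nth 0 lam r.-1).+1 (nth 0 mu r.-1 - nth 0 lam r.-1)]%N).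
apply/allpairsPdep/idP => [[r' [c' [hr hc [-> ->]]]]|h].
  by move: hr hc; rewrite !mem_iota => hr hc; lia.
by exists r, c; rewrite !mem_iota; split => //; lia.
Qed.

Section Ribbon.
Variables (mu lam : seq nat) (i m H : nat).
Hypotheses (hmu : sorted geq mu) (hrib : ribbon_shape mu lam i m H).

Let mono a b : (a <= b)%N -> (nth 0 mu b <= nth 0 mu a)%N := nth_geq hmu.

Lemma ribbon_shape_le R : (nth 0 lam R <= nth 0 mu R)%N.
Proof.
case: hrib => h1 h2 h3 h4 [h5 h6].
have [hR|hR] := ltnP R i; first by rewrite h5; auto.
have [hR'|hR'] := ltnP H R; first by rewrite h5; auto.
have [e|hne] := eqVneq R H; first by rewrite e h4 ltnW.
by have := h6 R; have := mono (leqnSn R); lia.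
Qed.

Lemma ribbon_shape_sorted : sorted geq lam.
Proof.
case: hrib => h1 h2 h3 h4 [h5 h6]; apply: nth_geqP => R.
have [hR|hR] := ltnP R i.
  rewrite (h5 R); last by left.
  exact: leq_trans (ribbon_shape_le _) (mono (leqnSn _)).
have [hR'|hR'] := ltnP H R.
  rewrite (h5 R) ?(h5 R.+1); [exact: mono (leqnSn _)|right; lia|by right].
have [e|hne] := eqVneq R H; first by rewrite e h4 h5 ?h3 //; right; apply: ltnSn.
have [e|hne'] := eqVneq R.+1 H.
  by have := h6 R; rewrite e h4; lia.
by have := h6 R; have := h6 R.+1; have := mono (leqnSn R.+1); lia.
Qed.

Variable k : nat.
Hypothesis hH : (H < k)%N.

Lemma mem_ribbon_shape r c : (r, c) \in skew_cells k mu lam ->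
  [/\ (1 <= r)%N, (i <= r.-1 <= H)%N & (nth 0 lam r.-1 < c <= nth 0 mu r.-1)%N].
Proof.
case: hrib => h1 h2 h3 h4 [h5 h6].
rewrite mem_skew_cells => /andP[hr hc]; split => //; first by lia.
apply/andP; split; rewrite leqNgt; apply/negP => hR.
  by have := h5 r.-1 (or_introl hR); lia.
by have := h5 r.-1 (or_intror hR); lia.
Qed.

Lemma ribbon_shape_row R : (i <= R <= H)%N ->
  (R.+1, nth 0%N mu R) \in skew_cells k mu lam.
Proof.
case: hrib => h1 h2 h3 h4 [h5 h6] hR.
rewrite mem_skew_cells /= leqnn andbT; apply/andP; split; first by lia.
have [e|hne] := eqVneq R H; first by rewrite e h4.
by have := h6 R; have := mono (leqnSn R); lia.
Qed.

(** Each row is an interval, and since lam_R + 1 = mu_(R+1) the first box of row R lies directly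
    above the last box of row R+1. *)
Lemma ribbon_shape_connected : connected_cells (skew_cells k mu lam).
Proof.
case: hrib => h1 h2 h3 h4 [h5 h6] S [[r0 c0] [hc0 hS0]] hadj.
pose Row R := forall c, (R.+1, c) \in skew_cells k mu lam -> S (R.+1, c).
have hrow R c d : (R.+1, c) \in skew_cells k mu lam -> S (R.+1, c) ->
   (R.+1, d) \in skew_cells k mu lam -> S (R.+1, d).
  rewrite !mem_skew_cells /= => /andP[hR hc] hS /andP[_ hd].
  have up e : (c + e <= nth 0 mu R)%N -> S (R.+1, c + e)%N.
    elim: e => [|e IH] he; first by rewrite addn0.
    apply: (hadj (R.+1, c + e)%N); rewrite ?mem_skew_cells /adjacent /=; try lia.
    by apply: IH; lia.
  have dn e : (nth 0 lam R < c - e)%N -> S (R.+1, c - e)%N.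
    elim: e => [|e IH] he; first by rewrite subn0.
    apply: (hadj (R.+1, c - e)%N); rewrite ?mem_skew_cells /adjacent /=; try lia.
    by apply: IH; lia.
  case: (leqP c d) => hcd; first by rewrite -(subnKC hcd); apply: up; lia.
  by rewrite (_ : d = c - (c - d))%N; [apply: dn|]; lia.
have hvert R : (i <= R < H)%N -> Row R <-> Row R.+1.
  move=> hR; have e := h6 R hR.
  have m1 : (R.+2, nth 0%N mu R.+1) \in skew_cells k mu lam by apply: ribbon_shape_row; lia.
  have m2 : (R.+1, nth 0%N mu R.+1) \in skew_cells k mu lam.
    by rewrite mem_skew_cells /=; have := mono (leqnSn R); lia.
  split=> h c hc.
    apply: (hrow _ _ _ m1) => //.
    by apply: (hadj _ _ m2 m1); [rewrite /adjacent /=; lia|apply: h].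
  apply: (hrow _ _ _ m2) => //.
  by apply: (hadj _ _ m1 m2); [rewrite /adjacent /=; lia|apply: h].
have hi R : (i <= R <= H)%N -> Row R <-> Row i.
  elim: R => [|R IH] hR; first by have -> : i = 0%N by lia.
  have [->//|hne] := eqVneq R.+1 i.
  by rewrite -hvert ?IH //; lia.
have [hr0 hr0H _] := mem_ribbon_shape hc0.
have r0i : Row i.
  rewrite -(hi r0.-1) // => c; rewrite prednK // => hc.
  by move: hc0 hS0 hc; rewrite -(prednK hr0) => hc0 hS0; apply: hrow hc0 hS0.
move=> [r c] hrc; have [hr hrH _] := mem_ribbon_shape hrc.
have : Row r.-1 by rewrite hi.
by move=> /(_ c); rewrite prednK //; apply.
Qed.

Lemma ribbon_shape_ribbon : ribbon_head_row k mu lam i.+1.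
Proof.
case: (hrib) => h1 h2 h3 h4 [h5 h6].
have hi := @ribbon_shape_row i; rewrite leqnn h1 in hi.
split.
- exact: ribbon_shape_le.
- by apply/eqP => e; move: (hi isT); rewrite e.
- exact: ribbon_shape_connected.
(* A square would need lam_R < c and c + 1 <= mu_(R+1), against lam_R + 1 = mu_(R+1). *)
- move=> [r [c [/mem_ribbon_shape[a1 a2 a3] _ _ /mem_ribbon_shape[b1 b2 b3]]]].
  rewrite /= in b2 b3; have := h6 r.-1; rewrite prednK // => g; lia.
split; first by exists (nth 0%N mu i); apply: hi.
by move=> r c /mem_ribbon_shape[]; lia.
Qed.

Lemma ribbon_shape_ht : ribbon_ht k mu lam = (H - i).+1.
Proof.
case: (hrib) => h1 h2 h3 h4 [h5 h6].
rewrite /ribbon_ht -(size_iota i.+1 (H - i).+1); apply/perm_size/uniq_perm.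
- exact: undup_uniq.
- exact: iota_uniq.
move=> r; rewrite mem_undup mem_iota; apply/mapP/idP => [[[r' c] /mem_ribbon_shape[] /=]|hr].
  by lia.
exists (r, nth 0%N mu r.-1) => //.
by have := @ribbon_shape_row r.-1; rewrite prednK; last lia; apply; lia.
Qed.

Lemma ribbon_shape_wd : ribbon_wd k mu lam = (nth 0 mu i - m)%N.
Proof.
case: (hrib) => h1 h2 h3 h4 [h5 h6].
rewrite /ribbon_wd -(size_iota m.+1 (nth 0 mu i - m)%N); apply/perm_size/uniq_perm.
- exact: undup_uniq.
- exact: iota_uniq.
move=> c; rewrite mem_undup mem_iota; apply/mapP/idP => [[[r c'] /mem_ribbon_shape[] /=]|hc].
  move=> r1 r2 r3 ->; have := mono (_ : i <= r.-1)%N.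
  have : (m <= nth 0 lam r.-1)%N.
    by rewrite -h4; apply: nth_geq; [apply: ribbon_shape_sorted|lia].
  by lia.
have [R [hR hRc]] : exists R, (i <= R <= H)%N /\ (nth 0 lam R < c <= nth 0 mu R)%N.
  (* Going down from the head row, the last row of the ribbon that still reaches column c contains a
     box in it. *)
  suff aux j : (i <= j <= H)%N -> (c <= nth 0 mu j)%N ->
      exists R, (i <= R <= H)%N /\ (nth 0 lam R < c <= nth 0 mu R)%N.
    by apply: (aux i); lia.
  have [N] := ubnP (H - j); elim: N j => // N IH j hN hij hcj.
  have [e|hne] := eqVneq j H; first by exists H; rewrite e in hcj; rewrite h4; lia.
  have [hlt|hge] := ltnP (nth 0%N mu j.+1) c.
    have g : (nth 0%N lam j).+1 = nth 0%N mu j.+1 by apply: h6; lia.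
    by exists j; lia.
  by apply: (IH j.+1); lia.
by exists (R.+1, c) => //; rewrite mem_skew_cells /=; lia.
Qed.

End Ribbon.

(** The converse of [ribbon_shape_ribbon]. Connectedness gives lam_R < mu_(R+1) for consecutive
    rows, and the absence of a 2x2 square gives mu_(R+1) <= lam_R + 1. *)
Lemma ribbon_shapeP k mu lam i : size mu = k -> size lam = k ->
  sorted geq mu -> sorted geq lam ->
  ribbon_head_row k mu lam i.+1 ->
  exists m H, [/\ (m < nth 0 mu i)%N, (H < k)%N & ribbon_shape mu lam i m H].
Proof.
move=> smu slam hmu hlam [hle _ hconn hsq [[c0 hc0] htop]].
have mem R c : (R < k)%N -> (nth 0 lam R < c <= nth 0 mu R)%N ->
    (R.+1, c) \in skew_cells k mu lam by move=> h1 h2; rewrite mem_skew_cells /=; lia.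
have hik : (i < k)%N by move: hc0; rewrite mem_skew_cells; lia.
pose P R := (R < k)%N && (nth 0 lam R < nth 0 mu R)%N.
have exP : exists R, P R by exists i; move: hc0; rewrite /P mem_skew_cells /=; lia.
have bP R : P R -> (R <= k)%N by rewrite /P; lia.
(* H is the last nonempty row of the skew shape. *)
case: (ex_maxnP exP bP) => H /andP[hH hHm] hmax.
have hbelow R : (H < R)%N -> nth 0%N lam R = nth 0%N mu R.
  move=> hR; have [hk|hk] := ltnP R k; last by rewrite !nth_default ?smu ?slam.
  apply/eqP; rewrite eqn_leq hle leqNgt; apply/negP => hlt.
  by have := hmax R; rewrite /P hk hlt => /(_ isT); lia.
have habove R : (R < i)%N -> nth 0%N lam R = nth 0%N mu R.
  move=> hR; apply/eqP; rewrite eqn_leq hle leqNgt; apply/negP => hlt.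
  by have := htop R.+1 (nth 0%N mu R); rewrite mem_skew_cells /= => h; lia.
have hiH : (i <= H)%N.
  by apply: hmax; move: hc0; rewrite /P mem_skew_cells /=; lia.
have hstep R : (i <= R < H)%N -> (nth 0%N lam R).+1 = nth 0%N mu R.+1.
  move=> hR; have mRR := nth_geq hmu (leqnSn R); have lRR := nth_geq hlam (leqnSn R).
  have h1 : (nth 0 lam R < nth 0 mu R.+1)%N.
    rewrite ltnNge; apply/negP => hbad.
    (* If mu_(R+1) <= lam_R, the boxes down to row R are closed under adjacency, and connectedness
       would put row H among them. *)
    suff : (H.+1 <= R.+1)%N by lia.
    apply: (hconn (fun c => c.1 <= R.+1)%N _ _ (H.+1, nth 0%N mu H)).
    - by exists (i.+1, c0); split => //=; lia.
    - move=> [r1 c1] [r2 c2] /=; rewrite !mem_skew_cells /adjacent /= => g1 g2 g3 g4.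
      rewrite leqNgt; apply/negP => g5.
      have [e1 e2] : r1 = R.+1 /\ r2 = R.+2 by lia.
      by subst; move: g1 g2 g3 => /=; lia.
    - by apply: mem => //; rewrite hHm leqnn.
  have h2 : (nth 0 mu R.+1 <= (nth 0 lam R).+1)%N.
    (* Otherwise columns lam_R + 1 and lam_R + 2 contain a square in rows R and R+1. *)
    rewrite leqNgt; apply/negP => hbad; apply: hsq.
    exists R.+1, (nth 0%N lam R).+1; split; apply: mem; lia.
  by lia.
exists (nth 0%N lam H), H; split => //.
  by apply: leq_trans hHm _; apply: nth_geq.
split => //.
  by move=> R hR; rewrite -hbelow //; apply: nth_geq => //; apply: ltnW.
by split => // R [] hR; [apply: habove|apply: hbelow].
Qed.

Lemma ribbon_shape_inj mu lam i m m' H H' : ribbon_shape mu lam i m H -> ribbon_shape mu lam i m' H' -> m = m'.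
Proof.
move=> [h1 h2 h3 h4 [h5 h6]] [g1 g2 g3 g4 [g5 g6]].
have [hlt|hlt|e] := ltngtP H H'; last by rewrite -h4 -g4 e.
  by have := h5 H' (or_intror hlt); lia.
by have := g5 H (or_intror hlt); lia.
Qed.

Lemma mem_allseqs k m s : (s \in allseqs k m) = (size s == k) && all (fun a => a <= m)%N s.
Proof.
elim: k s => [|k IH] s; first by rewrite inE; case: s.
have -> : allseqs k.+1 m = [seq a :: s | a <- iota 0 m.+1, s <- allseqs k m] by [].
apply/allpairsPdep/idP => [[a [s' [ha hs' ->]]]|].
  move: ha hs'; rewrite IH mem_iota /= eqSS => ha /andP[-> ->].
  by rewrite andbT; lia.
case: s => // a s /andP[hs /andP[ha has]]; exists a, s; split => //.
  by rewrite mem_iota; lia.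
by rewrite IH -eqSS; apply/andP; split.
Qed.

Lemma mem_boxparts n k s : (s \in boxparts n k) = in_box n k s.
Proof. by rewrite mem_filter mem_allseqs /in_box andbC andbA. Qed.

Lemma boxparts_uniq n k : uniq (boxparts n k).
Proof.
rewrite /boxparts; move: (n - k)%N => m; apply: filter_uniq; elim: k => // k IH.
have -> : allseqs k.+1 m = [seq a :: s | a <- iota 0 m.+1, s <- allseqs k m] by [].
by apply: allpairs_uniq; rewrite ?iota_uniq // => -[a s] [b r] _ _ /= [-> ->].
Qed.

Lemma ribbon_removed_in_box n k mu i m : in_box n k mu -> (i < k)%N -> (m < nth 0 mu i)%N ->
  in_box n k (ribbon_removed mu i m).
Proof.
case/and3P => /eqP sm am om hi hm.
have hi' : (i < size mu)%N by rewrite sm.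
have hr := ribbon_removedP om hi' hm.
apply/and3P; split.
- by rewrite size_ribbon_removed ?sm.
- apply/(all_nthP 0%N) => R hR /=; apply: leq_trans (ribbon_shape_le om hr R) _.
  by apply: (allP am); apply: mem_nth; rewrite size_ribbon_removed ?sm in hR *.
exact: ribbon_shape_sorted om hr.
Qed.

(** Turns the sum over ribbons in [Dop] into the sum over break points m in [rows_mulx]:
    [ribbon_shapeP] shows that every ribbon arises, [ribbon_shape_inj] that it arises once. *)
Lemma ribbons_perm n k mu i : in_box n k mu -> (i < k)%N ->
  perm_eq [seq lam <- boxparts n k | isb (ribbon_head_row k mu lam i.+1)]
          [seq ribbon_removed mu i m | m <- iota 0 (nth 0 mu i)].
Proof.
move=> hmu hi; have /and3P[/eqP sm am om] := hmu.
have hr m : (m < nth 0 mu i)%N -> ribbon_shape mu (ribbon_removed mu i m) i m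
    (i + count (fun c => m < c)%N (drop i.+1 mu)).
  by move=> hm; apply: ribbon_removedP; rewrite ?sm.
have hH m : (i + count (fun c => m < c)%N (drop i.+1 mu) < k)%N.
  by have := count_size (fun c => m < c)%N (drop i.+1 mu); rewrite size_drop sm; lia.
apply: uniq_perm.
- exact/filter_uniq/boxparts_uniq.
- rewrite map_inj_in_uniq ?iota_uniq // => m m'; rewrite !mem_iota !add0n /= => hm hm' e.
  by have h1 := hr m hm; have h2 := hr m' hm'; rewrite e in h1; apply: ribbon_shape_inj h1 h2.
move=> lam; rewrite mem_filter mem_boxparts; apply/andP/mapP => [[/isbP hrl hl]|[m]].
  have /and3P[/eqP sl al ol] := hl.
  have [m [H [hm _ hrib]]] := ribbon_shapeP sm sl om ol hrl.
  exists m; first by rewrite mem_iota.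
  by apply: ribbon_shape_uniq hrib (hr m hm) _; rewrite size_ribbon_removed ?sm.
rewrite mem_iota add0n /= => hm ->; split; last exact: ribbon_removed_in_box.
exact: introT (isbP _) (ribbon_shape_ribbon om (hr m hm) (hH m)).
Qed.

Lemma ribbon_removed_ht_wd n k mu i m : in_box n k mu -> (i < k)%N -> (m < nth 0 mu i)%N ->
  (ribbon_ht k mu (ribbon_removed mu i m)).-1 = count (fun c => m < c)%N (drop i.+1 mu) /\
  ribbon_wd k mu (ribbon_removed mu i m) = (nth 0 mu i - m)%N.
Proof.
case/and3P=> /eqP sm am om hi hm.
have hr : ribbon_shape mu (ribbon_removed mu i m) i m
    (i + count (fun c => m < c)%N (drop i.+1 mu)).
  by apply: ribbon_removedP; rewrite ?sm.
have hH : (i + count (fun c => m < c)%N (drop i.+1 mu) < k)%N.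
  by have := count_size (fun c => m < c)%N (drop i.+1 mu); rewrite size_drop sm; lia.
by rewrite (ribbon_shape_ht om hr hH) (ribbon_shape_wd om hr hH) /= addKn.
Qed.

(** * Grassmannian permutations *)

Definition wtop (k : nat) (nu : seq nat) : seq nat :=
  [seq (nth 0 nu (k - a).-1 + a.+1)%N | a <- iota 0 k].

Lemma wnuE n k nu : wnu n k nu = wtop k nu ++ [seq v <- iota 1 n | v \notin wtop k nu].
Proof. by []. Qed.

Lemma size_wtop k nu : size (wtop k nu) = k.
Proof. by rewrite size_map size_iota. Qed.

Lemma nth_wtop k nu a : (a < k)%N -> nth 0%N (wtop k nu) a = (nth 0 nu (k - a).-1 + a.+1)%N.
Proof. by move=> ha; rewrite (nth_map 0%N) ?size_iota // nth_iota. Qed.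

Lemma wnu_perm n k nu : (k <= n)%N -> in_box n k nu -> perm_eq (wnu n k nu) (iota 1 n).
Proof.
move=> hk /and3P[/eqP sn an on].
have le R : (nth 0 nu R <= n - k)%N.
  have [hR|hR] := ltnP R (size nu); last by rewrite nth_default.
  exact: (allP an) (mem_nth _ hR).
have sub v : v \in wtop k nu -> v \in iota 1 n.
  by move=> /mapP[a]; rewrite !mem_iota => ha ->; have := le (k - a).-1; lia.
have lt a b : (a < b < k)%N -> (nth 0 nu (k - a).-1 + a.+1 < nth 0 nu (k - b).-1 + b.+1)%N.
  move=> hab; have := @nth_geq nu (k - b).-1 (k - a).-1 on; lia.
apply: uniq_perm; rewrite ?iota_uniq //.
  rewrite wnuE cat_uniq filter_uniq ?iota_uniq // andbT; apply/andP; split.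
    rewrite map_inj_in_uniq ?iota_uniq // => a b; rewrite !mem_iota => ha hb e.
    by have := lt a b; have := lt b a; lia.
  by apply/hasPn => v; rewrite mem_filter => /andP[].
move=> v; rewrite wnuE mem_cat mem_filter.
by case: (boolP (v \in wtop k nu)) => //= /sub ->.
Qed.

Lemma swapn_id l v : v != l -> v != l.+1 -> swapn l v = v.
Proof. by rewrite /swapn => /negbTE-> /negbTE->. Qed.

Lemma swapn_l l : swapn l l = l.+1.
Proof. by rewrite /swapn eqxx. Qed.

Lemma swapn_r l : swapn l l.+1 = l.
Proof. by rewrite /swapn eqxx gtn_eqF. Qed.

Lemma map_swapn_id l (s : seq nat) : l \notin s -> l.+1 \notin s -> map (swapn l) s = s.
Proof.
move=> h1 h2; apply: map_id_in => v hv; apply: swapn_id.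
  by apply: contraNneq h1 => <-.
by apply: contraNneq h2 => <-.
Qed.

Lemma iota1_split l n : (1 <= l < n)%N ->
  iota 1 n = iota 1 l.-1 ++ l :: l.+1 :: iota l.+2 (n - l.+1).
Proof.
move=> hl; rewrite (_ : n = l.-1 + (2 + (n - l.+1)))%N; last by lia.
rewrite iotaD (_ : 1 + l.-1 = l)%N; last by lia.
by congr cat; rewrite /=; do 2!congr cons; congr iota; lia.
Qed.

(** Only one of the consecutive values l, l+1 survives each filter, so replacing one by the other
    keeps the list increasing. *)
Lemma filter_swapn l n (P : pred nat) : (1 <= l < n)%N -> ~~ P l -> P l.+1 ->
  [seq v <- iota 1 n | P (swapn l v)] = map (swapn l) (filter P (iota 1 n)).
Proof.
move=> hl hPl hPr.
rewrite (iota1_split hl) -[l :: l.+1 :: _]/([:: l; l.+1] ++ _) !filter_cat !map_cat; congr cat; [|congr cat].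
- rewrite map_swapn_id; try by rewrite mem_filter mem_iota; lia.
  by apply: eq_in_filter => v; rewrite mem_iota => hv; rewrite swapn_id //; lia.
- by rewrite /= swapn_l swapn_r hPr (negbTE hPl) /= swapn_r.
rewrite map_swapn_id; try by rewrite mem_filter mem_iota; lia.
by apply: eq_in_filter => v; rewrite mem_iota => hv; rewrite swapn_id //; lia.
Qed.

Lemma last_nonzero (s : seq nat) : s = nseq (size s) 0%N \/
  exists u m z, s = u ++ m.+1 :: nseq z 0%N.
Proof.
elim/last_ind: s => [|s [|c] IH]; [by left| |by right; exists s, c, 0%N; rewrite cats1].
have rc z : rcons (nseq z 0%N) 0%N = nseq z.+1 0%N.
  by elim: z => //= z ->.
case: IH => [->|[u [m [z ->]]]]; first by left; rewrite size_rcons size_nseq rc.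
by right; exists u, m, z.+1; rewrite rcons_cat rcons_cons rc.
Qed.

Section Grassmannian.
Variables (A : pzRingType) (n : nat) (t : nat -> A).
Hypothesis tbraid : forall i, (1 <= i)%N -> (i.+1 < n)%N ->
  t i * t i.+1 * t i = t i.+1 * t i * t i.+1.
Hypothesis tfar : forall i j, (1 <= i)%N -> (j < n)%N -> (i.+1 < j)%N ->
  t i * t j = t j * t i.

Lemma rows_nseq0 b z : rows t b (nseq z 0%N) = 1.
Proof. by elim: z => //= z ->; rewrite /run mulr1. Qed.

(** Induction on the number of boxes: adding the last box of the last nonzero row multiplies the
    permutation on the left by one simple reflection and increases its length. *)
Lemma prod_red_wnu k mu : (k <= n)%N -> in_box n k mu -> prod_red t (wnu n k mu) = rows t 0 mu.
Proof.
move=> hk; have [N] := ubnP (sumn mu); elim: N mu => // N IH mu hN hmu.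
have /and3P[/eqP sm am om] := hmu.
case: (last_nonzero mu) => [e|[u [m [z e]]]].
  have hw : wnu n k mu = iota 1 n.
    have -> : wnu n k mu = iota 1 k ++ [seq v <- iota 1 n | v \notin iota 1 k].
      rewrite wnuE; suff -> : wtop k mu = iota 1 k by [].
      apply: (eq_from_nth (x0 := 0%N)); rewrite size_wtop ?size_iota // => a ha.
      by rewrite nth_wtop // nth_iota // e nth_nseq; case: ifP.
    rewrite -(subnKC hk) iotaD; congr cat.
    rewrite filter_cat (_ : filter _ (iota 1 k) = [::]).
      by apply/all_filterP/allP => v; rewrite !mem_iota; lia.
    by apply/eqP; rewrite -size_eq0 size_filter -leqn0 leqNgt -has_count -all_predC;
       apply/allP => v /= ->.
  rewrite hw e rows_nseq0 /prod_red redword_sorted ?big_nil // => j.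
  by rewrite size_iota => hj; rewrite !nth_iota; lia.
(* With z empty rows below, the run of the last nonzero row starts at letter z+1, so l is its
   leftmost letter; it is also the value of w_mu' at 0-based position z. *)
pose mu' := u ++ m :: nseq z 0%N; pose l := (z.+1 + m)%N.
have sz : (size u + z.+1 = k)%N by rewrite -sm e size_cat /= size_nseq.
have nmu R : nth 0%N mu R = if (R < size u)%N then nth 0%N u R else if R == size u then m.+1 else 0%N.
  rewrite e nth_cat; case: ltnP => // hR; case: eqP => [->|hne]; first by rewrite subnn.
  by rewrite (_ : R - size u = (R - size u).-1.+1)%N /= ?nth_nseq ?if_same //; lia.
have nmu' R : nth 0%N mu' R = if (R < size u)%N then nth 0%N u R else if R == size u then m else 0%N.
  rewrite nth_cat; case: ltnP => // hR; case: eqP => [->|hne]; first by rewrite subnn.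
  by rewrite (_ : R - size u = (R - size u).-1.+1)%N /= ?nth_nseq ?if_same //; lia.
have big R : (R < size u)%N -> (m < nth 0 u R)%N.
  move=> hR; have := nth_geq om (ltnW hR); rewrite !nmu hR ltnn eqxx; lia.
have bnd : (m.+1 <= n - k)%N by apply: (allP am); rewrite e mem_cat mem_head orbT.
have hmu' : in_box n k mu'.
  apply/and3P; split.
  - by rewrite size_cat /= size_nseq; lia.
  - move: am; rewrite e !all_cat /= => /andP[-> /andP[_ ->]]; rewrite andbT; lia.
  apply: nth_geqP => R; have hb := big R.
  have := nth_geq om (leqnSn R); rewrite !nmu !nmu'.
  by case: (ltngtP R (size u)) => h1; case: (ltngtP R.+1 (size u)) => h2 h3; lia.
have topsw : wtop k mu = map (swapn l) (wtop k mu').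
  rewrite -map_comp; apply/eq_in_map => a; rewrite mem_iota => ha /=.
  have hb := big (k - a).-1; rewrite nmu nmu' /swapn /l.
  by case: (ltngtP (k - a).-1 (size u)) => h1; do ?[case: eqP => //=]; lia.
have ltop : l \in wtop k mu'.
  apply/mapP; exists z; first by rewrite mem_iota; lia.
  by rewrite nmu' ifF ?ifT /l; lia.
have ltop' : l.+1 \notin wtop k mu'.
  apply/mapP => -[a]; rewrite mem_iota nmu' /l => ha.
  have hb := big (k - a).-1.
  by case: (ltngtP (k - a).-1 (size u)) => h1; lia.
have wsw : wnu n k mu = map (swapn l) (wnu n k mu').
  rewrite !wnuE map_cat -topsw; congr cat.
  rewrite -filter_swapn ?negbK //; last by rewrite /l; lia.
  apply: eq_filter => v; rewrite topsw -{1}(swapnK l v) mem_map //.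
  exact: (can_inj (swapnK l)).
have pw := wnu_perm hk hmu'.
have swapn' : size (wnu n k mu') = n by rewrite (perm_size pw) size_iota.
have lin : l.+1 \in wnu n k mu' by rewrite (perm_mem pw) mem_iota /l; lia.
rewrite wsw; have [|||||_ ->] := @prod_red_swap_values A n t tbraid tfar (wnu n k mu') l z (index l.+1 (wnu n k mu')).
- by rewrite swapn'.
- by rewrite swapn'.
(* The value l+1 is not among the first k values, so it stands to the right of l. *)
- rewrite index_mem lin andbT ltnNge; apply/negP => hle.
  have := nth_index 0%N lin; rewrite wnuE nth_cat size_wtop -wnuE ifT; last by lia.
  by move=> e'; move/negP: ltop'; apply; rewrite -e' mem_nth // size_wtop; lia.
- rewrite wnuE nth_cat size_wtop ifT ?nth_wtop ?nmu'; try lia.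
  by rewrite ifF ?ifT /l; lia.
- exact: nth_index.
rewrite IH //; last first.
  by move: hN; rewrite e !sumn_cat /=; lia.
rewrite e !rows_cat /= size_nseq rows_nseq0 !mul1r !add0n mulrA.
by congr (_ * _).
Qed.
End Grassmannian.

(** * The symmetrizer of the Young subgroup *)

Definition young (n k : nat) : seq (seq nat) :=
  [seq a ++ b | a <- permutations (iota 1 k), b <- permutations (iota k.+1 (n - k))].

Lemma mem_young n k v : reflect (exists a b, [/\ perm_eq a (iota 1 k),
    perm_eq b (iota k.+1 (n - k)) & v = a ++ b]) (v \in young n k).
Proof.
apply: (iffP allpairsPdep) => -[a [b]]; rewrite ?mem_permutations => -[h1 h2 h3];
  by exists a, b; rewrite ?mem_permutations.
Qed.

Lemma young_uniq n k : uniq (young n k).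
Proof.
apply: allpairs_uniq; rewrite ?permutations_uniq // => -[a b] [a' b'].
case/allpairsP => -[a1 b1] /= [h1 _ [-> ->]] /allpairsP[[a2 b2] /= [h2 _ [-> ->]]] /eqP.
rewrite !mem_permutations in h1 h2.
by rewrite eqseq_cat ?(perm_size h1) ?(perm_size h2) // => /andP[/eqP-> /eqP->].
Qed.

Lemma young_perm n k v : (k <= n)%N -> v \in young n k -> perm_eq v (iota 1 n).
Proof.
move=> hk /mem_young[a [b [pa pb ->]]].
by rewrite -[X in iota 1 X](subnKC hk) iotaD add1n perm_cat.
Qed.

Lemma young_block n k v : (k <= n)%N -> v \in young n k ->
  forall s u, (s < k)%N -> (k <= u < size v)%N -> (nth 0 v s < nth 0 v u)%N.
Proof.
move=> hk /mem_young[a [b [pa pb ->]]] s u hs hu.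
have sa : size a = k by rewrite (perm_size pa) size_iota.
rewrite !nth_cat sa hs ifF; last by lia.
have h1 : nth 0%N a s \in iota 1 k by rewrite -(perm_mem pa) mem_nth ?sa.
have h2 : nth 0%N b (u - k) \in iota k.+1 (n - k).
  by rewrite -(perm_mem pb) mem_nth //; move: hu; rewrite size_cat sa; lia.
by move: h1 h2; rewrite !mem_iota; lia.
Qed.

Lemma map_swapn_iota l m j : (l.+1 < m)%N || (m <= l)%N && (l.+1 < m + j)%N || (m + j <= l)%N ->
  perm_eq (map (swapn l) (iota m j)) (iota m j).
Proof.
move=> h; apply: uniq_perm; rewrite ?iota_uniq //.
  by rewrite map_inj_uniq ?iota_uniq //; apply: (can_inj (swapnK l)).
move=> v; rewrite -{1}(swapnK l v) mem_map; last exact: (can_inj (swapnK l)).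
by rewrite !mem_iota /swapn; do ?[case: eqP => //=]; lia.
Qed.

Lemma young_swapn n k l v : (1 <= l < n)%N -> l != k -> v \in young n k ->
  map (swapn l) v \in young n k.
Proof.
move=> hl hk /mem_young[a [b [pa pb ->]]]; apply/mem_young.
exists (map (swapn l) a), (map (swapn l) b); rewrite map_cat; split => //.
  by apply: perm_trans (perm_map _ pa) (map_swapn_iota _); lia.
by apply: perm_trans (perm_map _ pb) (map_swapn_iota _); lia.
Qed.

Lemma young_swapn_perm n k l : (1 <= l < n)%N -> l != k ->
  perm_eq (map (map (swapn l)) (young n k)) (young n k).
Proof.
move=> hl hk; have inv : involutive (map (swapn l)).
  by move=> v; rewrite -map_comp map_id_in // => i _ /=; apply: swapnK.
apply: uniq_perm; rewrite ?young_uniq //.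
  by rewrite map_inj_uniq ?young_uniq //; apply: can_inj inv.
move=> v; rewrite -{1}(inv v) mem_map; last exact: can_inj inv.
by apply/idP/idP => /(young_swapn hl hk); rewrite ?inv.
Qed.

Lemma sum_interval n lo hi : (\sum_(i < n) (lo <= i < hi) = minn n hi - lo)%N.
Proof.
elim: n => [|n IH]; first by rewrite big_ord0; lia.
by rewrite big_ord_recr /= IH; lia.
Qed.

(** Keeps the truncated subtraction in the exponent of q from cutting anything off. Inversions occur
    only inside one of the two blocks. *)
Lemma young_len n k v : (k <= n)%N -> v \in young n k -> (perm_len v <= dd n k)%N.
Proof.
move=> hk hv; have hb := young_block hk hv.
have sv : size v = n by rewrite (perm_size (young_perm hk hv)) size_iota.
rewrite /perm_len /dd sv exchange_big /=.
(* The number of positions before j in the block of j. *)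
pose g (j : nat) : nat := if (j < k)%N then j else (j - k)%N.
apply: (@leq_trans (\sum_(j < n) g j)%N).
  apply: leq_sum => j _.
  pose lo : nat := if (j < k)%N then 0%N else k.
  apply: (@leq_trans (\sum_(i < n) (lo <= i < j))%N).
    apply: leq_sum => i _; have [hij|//] := ltnP i j; rewrite andbT andTb /lo.
    case: (ltnP j k) => hj; first by case: (_ < _)%N.
    have [hki|hki] := leqP k i; first by case: (_ < _)%N.
    by have := hb i j hki; rewrite sv hj ltn_ord => /(_ isT) h; rewrite (leq_gtF (ltnW h)).
  by rewrite sum_interval /lo /g; case: ltnP => hj; have := ltn_ord j; lia.
rewrite -(big_mkord xpredT g).
rewrite (big_cat_nat (n := k)) //=; apply: leq_add.
  rewrite -bin2_sum; apply: eq_leq; apply: eq_big_nat => j hj; rewrite /g ifT //; lia.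
rewrite -{1}[k]add0n big_addn -bin2_sum; apply: eq_leq; apply: eq_big_nat => j hj.
by rewrite /g addnK ifF //; lia.
Qed.

Section Symmetrizer.
Variables (A : pzRingType) (n k : nat) (p q : A) (t : nat -> A).
Hypothesis hk : (k <= n)%N.
Hypothesis pC : forall y, p * y = y * p.
Hypothesis qC : forall y, q * y = y * q.
Hypothesis tquad : forall i, (1 <= i < n)%N -> t i * t i = (p - q) * t i + p * q.
Hypothesis tbraid : forall i, (1 <= i)%N -> (i.+1 < n)%N ->
  t i * t i.+1 * t i = t i.+1 * t i * t i.+1.
Hypothesis tfar : forall i j, (1 <= i)%N -> (j < n)%N -> (i.+1 < j)%N ->
  t i * t j = t j * t i.

Definition symz : A := \sum_(v <- young n k) q ^+ (dd n k - perm_len v) * prod_red t v.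

(** The terms of v and s_l v together give a power of q times (q + t_l) t_v, and the quadratic
    relation says t_l (q + t_l) = p (q + t_l). *)
Lemma t_symz l : (1 <= l < n)%N -> l != k -> t l * symz = p * symz.
Proof.
move=> hl hlk.
pose up (v : seq nat) := (index l v < index l.+1 v)%N.
have inj := can_inj (swapnK l).
have il v : index l (map (swapn l) v) = index l.+1 v by rewrite -{1}(swapn_r l) index_map.
have ir v : index l.+1 (map (swapn l) v) = index l v by rewrite -{1}(swapn_l l) index_map.
have E : symz = \sum_(v <- young n k | up v)
    q ^+ (dd n k - perm_len v).-1 * ((q + t l) * prod_red t v).
  rewrite /symz (bigID up) /=.
  rewrite -[X in _ + X](perm_big _ (young_swapn_perm hl hlk)) /= big_map.
  have -> : \sum_(j <- young n k | ~~ up (map (swapn l) j))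
      q ^+ (dd n k - perm_len (map (swapn l) j)) * prod_red t (map (swapn l) j) =
    \sum_(j <- young n k | up j)
      q ^+ (dd n k - perm_len (map (swapn l) j)) * prod_red t (map (swapn l) j).
    rewrite big_seq_cond [RHS]big_seq_cond; apply: eq_bigl => v.
    case hv: (v \in young n k) => //=; rewrite /up il ir -leqNgt leq_eqVlt.
    case: eqP => // e; have hp := young_perm hk hv.
    have h1 : l \in v by rewrite (perm_mem hp) mem_iota; lia.
    have h2 : l.+1 \in v by rewrite (perm_mem hp) mem_iota; lia.
    by have := nth_index 0%N h2; rewrite -e nth_index //; lia.
  rewrite -big_split /= big_seq_cond [RHS]big_seq_cond; apply: eq_bigr => v /andP[hv hup].
  have hp := young_perm hk hv.
  have sv : size v = n by rewrite (perm_size hp) size_iota.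
  have h1 : l \in v by rewrite (perm_mem hp) mem_iota; lia.
  have h2 : l.+1 \in v by rewrite (perm_mem hp) mem_iota; lia.
  have [|||||hlen ->] := @prod_red_swap_values A n t tbraid tfar v l (index l v) (index l.+1 v).
  - by rewrite sv.
  - by rewrite sv.
  - by rewrite [(_ < _)%N]hup index_mem.
  - exact: nth_index.
  - exact: nth_index.
  have := young_len hk (young_swapn hl hlk hv); rewrite hlen => hd.
  have -> : (dd n k - perm_len v = (dd n k - (perm_len v).+1).+1)%N by lia.
  by rewrite exprSr /= -!mulrA -mulrDr -mulrDl.
rewrite E !mulr_sumr; apply: eq_bigr => v _.
rewrite [LHS]mulrA -(qXC qC) -mulrA [RHS]mulrA pC -mulrA; congr (_ * _).
rewrite !mulrA; congr (_ * _).
rewrite !mulrDr tquad // mulrBl (qC (t l)) addrA.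
by rewrite [t l * q + _]addrC subrK addrC.
Qed.

Lemma symz_comm y : (forall l, (1 <= l < n)%N -> l != k -> y * t l = t l * y) ->
  y * symz = symz * y.
Proof.
move=> hy; rewrite mulr_sumr mulr_suml; apply: eq_big_seq => v hv.
rewrite mulrA -(qXC qC) -!mulrA; congr (_ * _).
have sv : size v = n by rewrite (perm_size (young_perm hk hv)) size_iota.
have aux : all (fun l => (1 <= l < n)%N && (l != k)) (redword v).
  apply/allP => l hl; rewrite -{1}sv mem_redword //=.
  exact: redword_block (young_block hk hv) hl.
rewrite /prod_red; elim: (redword v) aux => [|l s IH] /=; first by rewrite big_nil mulr1 mul1r.
move=> /andP[/andP[h1 h2] hs].
by rewrite big_cons mulrA hy // -!mulrA IH.
Qed.
End Symmetrizer.

(** * Elementary symmetric sums in variables that need not commute *)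

Section ElemSym.
Variables (A : pzRingType) (x : nat -> A).

Definition elsym (l : seq nat) (r : nat) : A :=
  \sum_(s <- incr_choose l r) \prod_(i <- s) x i.

Lemma elsym0 l : elsym l 0 = 1.
Proof. by case: l => [|a l]; rewrite /elsym big_seq1 big_nil. Qed.

Lemma elsym_nil r : elsym [::] r.+1 = 0.
Proof. by rewrite /elsym big_nil. Qed.

Lemma elsym_cons a l r : elsym (a :: l) r.+1 = x a * elsym l r + elsym l r.+1.
Proof.
rewrite /elsym /= big_cat big_map mulr_sumr; congr (_ + _).
by apply: eq_bigr => s _; rewrite big_cons.
Qed.

Lemma elsym_rcons a l r : elsym (rcons l a) r.+1 = elsym l r * x a + elsym l r.+1.
Proof.
elim: l r => [|b l IH] r /=.
  by rewrite elsym_cons !elsym_nil; case: r => [|r]; rewrite ?elsym0 ?elsym_nil ?mul1r ?mulr1 ?mul0r ?mulr0.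
rewrite elsym_cons IH; case: r => [|r].
  by rewrite !elsym_cons !elsym0 mulr1 mul1r addrCA.
by rewrite IH !elsym_cons mulrDr mulrDl !mulrA -!addrA; congr (_ + _); rewrite addrCA.
Qed.

(** Reversing the list of variables reverses each monomial; the order matters because the variables
    are not assumed to commute. *)
Lemma elsym_rev l r : elsym (rev l) r = \sum_(s <- incr_choose l r) \prod_(i <- rev s) x i.
Proof.
elim: l r => [|a l IH] [|r]; rewrite ?elsym0 ?[rev [::]]/([::]) ?elsym_nil.
- by rewrite big_seq1 big_nil.
- by rewrite big_nil.
- by rewrite big_seq1 big_nil.
rewrite rev_cons elsym_rcons !IH [incr_choose _ _]/= big_cat big_map mulr_suml; congr (_ + _).
by apply: eq_bigr => s _; rewrite rev_cons -cats1 big_cat big_seq1.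
Qed.

Lemma elsym_comm y l r : (forall i, i \in l -> y * x i = x i * y) -> y * elsym l r = elsym l r * y.
Proof.
elim: l r => [|a l IH] [|r] h; rewrite ?elsym0 ?elsym_nil ?mulr1 ?mul1r ?mulr0 ?mul0r //.
rewrite elsym_cons mulrDr mulrDl mulrA h ?mem_head // -!mulrA !IH //;
  by move=> i hi; apply: h; rewrite in_cons hi orbT.
Qed.

(** For adjacent a and b the sum involves x_a and x_b only through x_a + x_b and x_a x_b. *)
Lemma elsym_comm2 y a b u l r : (forall i, i \in u ++ l -> y * x i = x i * y) ->
  y * (x a + x b) = (x a + x b) * y -> y * (x a * x b) = x a * x b * y ->
  y * elsym (u ++ a :: b :: l) r = elsym (u ++ a :: b :: l) r * y.
Proof.
move=> h h1 h2.
elim: u r h => [|c u IH] [|r] h; rewrite ?elsym0 ?mulr1 ?mul1r //.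
- case: r => [|r].
    rewrite !elsym_cons !elsym0 !mulr1 addrA mulrDr mulrDl h1; congr (_ + _).
    exact: elsym_comm.
  have -> : elsym (a :: b :: l) r.+2 =
      x a * x b * elsym l r + ((x a + x b) * elsym l r.+1 + elsym l r.+2).
    by rewrite !elsym_cons mulrDr mulrDl -!addrA mulrA.
  have aux z r' : y * z = z * y -> y * (z * elsym l r') = z * elsym l r' * y.
    by move=> hz; rewrite mulrA hz -mulrA elsym_comm // mulrA.
  apply: commrD; first exact: aux.
  by apply: commrD; [apply: aux|apply: elsym_comm].
rewrite /= elsym_cons mulrDr mulrDl mulrA h ?mem_head // -!mulrA !IH //;
  by move=> i hi; apply: h; rewrite in_cons hi orbT.
Qed.
End ElemSym.

Lemma elsym_map (A : pzRingType) (x : nat -> A) (f : nat -> nat) l r :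
  elsym x (map f l) r = elsym (fun i => x (f i)) l r.
Proof.
elim: l r => [|a l IH] [|r]; rewrite ?elsym0 ?elsym_nil //= ?elsym_nil //.
by rewrite !elsym_cons !IH.
Qed.

(** * Composition of the operators *)

Section Composition.
Variables (H : algType rat) (n k : nat) (p q hb : H) (t x : nat -> H).
Hypothesis hk : (k <= n)%N.
Hypothesis pC : forall y, p * y = y * p.
Hypothesis qC : forall y, q * y = y * q.
Hypothesis hC : forall y, hb * y = y * hb.
Hypothesis tbraid : forall i, (1 <= i)%N -> (i.+1 < n)%N ->
  t i * t i.+1 * t i = t i.+1 * t i * t i.+1.
Hypothesis tfar : forall i j, (1 <= i)%N -> (j < n)%N -> (i.+1 < j)%N ->
  t i * t j = t j * t i.
Hypothesis tx : forall i j, (1 <= i < n)%N -> (1 <= j <= n)%N ->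
  j != i -> j != i.+1 -> t i * x j = x j * t i.
Hypothesis txi : forall i, (1 <= i < n)%N ->
  t i * x i = x i.+1 * t i + (hb - (p - q) * x i.+1).

(** [rows_mulx] read through the dictionary of ribbons. Z stands for the symmetrizer, possibly
    preceded by variables already inserted. *)
Lemma Dop_rows mu i Z : in_box n k mu -> (i < k)%N ->
  (forall l, (1 <= l < k - i)%N || (k < l < n)%N -> t l * Z = p * Z) ->
  \sum_(gm <- Dop p q n k hb x i.+1 [:: (1, mu)]) gm.1 * (rows t 0 gm.2 * Z) =
  rows t 0 mu * (x (k - i)%N * Z).
Proof.
move=> hmu hi hZ; have /and3P[/eqP sm am om] := hmu.
have him : (i < size mu)%N by rewrite sm.
have e : mu = take i mu ++ nth 0%N mu i :: drop i.+1 mu.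
  by rewrite -drop_nth // cat_take_drop.
have sd : (size (drop i.+1 mu)).+1 = (k - i)%N by rewrite size_drop sm; lia.
have st : (size (take i mu) + (size (drop i.+1 mu)).+1 = k)%N.
  by rewrite sd size_take him; lia.
have := @rows_mulx H n p q hb t x pC qC hC tbraid tfar tx txi (take i mu) (nth 0%N mu i)
  (drop i.+1 mu) Z; rewrite /= st sd -e => -> //.
rewrite /Dop /= cats0 big_cons big_map (perm_big _ (ribbons_perm hmu hi)) big_map /=.
have -> : (nth 0 mu i + k.+1 - i.+1 = k - i + nth 0 mu i)%N by lia.
rewrite mul1r; congr (_ + _).
rewrite -[X in iota 0 X]subn0 -/(index_iota _ _) big_mkord; apply: eq_bigr => m _.
by have [-> ->] := ribbon_removed_ht_wd hmu hi (ltn_ord m); rewrite mul1r.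
Qed.

Lemma Dop_scale i g mu : Dop p q n k hb x i [:: (g, mu)] =
  [seq (g * gm.1, gm.2) | gm <- Dop p q n k hb x i [:: (1, mu)]].
Proof.
rewrite /Dop /= !cats0 /= mul1r -map_comp; congr cons.
by apply: eq_map => lam /=; rewrite mul1r.
Qed.

Lemma Dop_flatten i L : Dop p q n k hb x i L =
  flatten [seq Dop p q n k hb x i [:: gm] | gm <- L].
Proof.
by rewrite /Dop; congr flatten; apply: eq_map => gm /=; rewrite cats0.
Qed.

Lemma Dop_in_box i L : all (fun gm => in_box n k gm.2) L ->
  all (fun gm => in_box n k gm.2) (Dop p q n k hb x i L).
Proof.
move/allP => hL; apply/allP => gm /flattenP[l /mapP[gm' /hL hgm' ->]].
rewrite in_cons => /orP[/eqP-> //|/mapP[lam]].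
by rewrite mem_filter => /andP[_]; rewrite mem_boxparts => hlam ->.
Qed.

Lemma foldr_Dop_in_box mu s : in_box n k mu ->
  all (fun gm => in_box n k gm.2) (foldr (Dop p q n k hb x) [:: (1, mu)] s).
Proof.
by move=> hmu; elim: s => [|j s' IHs]; [rewrite /= hmu|rewrite [foldr _ _ _]/= Dop_in_box].
Qed.

(* The rows of s are applied from the bottom up, so the variables x_{k+1-i} still to be
   crossed are untouched by the letters t_l, l < k - i0, which Z has to absorb. *)
Lemma foldr_Dop mu s i0 Z : in_box n k mu -> path ltn i0 s -> all (fun i => i <= k)%N s ->
  (forall l, (1 <= l < k - i0)%N || (k < l < n)%N -> t l * Z = p * Z) ->
  \sum_(gm <- foldr (Dop p q n k hb x) [:: (1, mu)] s) gm.1 * (rows t 0 gm.2 * Z) =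
  rows t 0 mu * (\prod_(i <- rev s) x (k.+1 - i)%N * Z).
Proof.
move=> hmu; elim: s i0 Z => [|i s IH] i0 Z /=.
  by move=> _ _ _; rewrite big_seq1 big_nil /= !mul1r.
move=> /andP[hi ps] /andP[hik hs] hZ.
case: i hi hik ps => // i hi hik ps.
have hall := foldr_Dop_in_box s hmu.
rewrite Dop_flatten big_flatten big_map.
rewrite (eq_big_seq (fun gm => gm.1 * (rows t 0 gm.2 * (x (k - i)%N * Z)))); last first.
  move=> [g la] hgm; have /= hla := allP hall _ hgm.
  rewrite Dop_scale big_map /= -(Dop_rows hla) //; last by move=> l hl; apply: hZ; lia.
  by rewrite mulr_sumr; apply: eq_bigr => gm _; rewrite -mulrA.
rewrite (IH i.+1) //.
  by rewrite rev_cons -cats1 big_cat big_seq1 /= subSS mulrA.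
(* The inserted variable x_(k-i) commutes with every t_l that the remaining operators need absorbed,
   since l + 1 < k - i or l > k. *)
move=> l hl; rewrite mulrA tx; [|lia|lia|lia|lia].
by rewrite -mulrA hZ ?(mulpC pC) //; lia.
Qed.
End Composition.

(** * The identity in the affine Hecke algebra *)

Lemma incr_choose_subseq l r s : s \in incr_choose l r -> subseq s l.
Proof.
elim: l r s => [|a l IH] [|r] s //=; rewrite ?inE; try by move/eqP->.
rewrite mem_cat => /orP[/mapP[s' /IH h ->]|/IH h]; first by rewrite /= eqxx.
by apply: subseq_trans h (subseq_cons l a).
Qed.

(** Apart from the terms aba and bab, the two expansions agree once a^2 + ca = b^2 + cb. *)
Lemma braid_shift (A : pzRingType) (a b c d : A) : (forall y, c * y = y * c) ->
  a * a + c * a = d -> b * b + c * b = d -> a * b * a = b * a * b ->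
  (a + c) * (b + c) * (a + c) = (b + c) * (a + c) * (b + c).
Proof.
move=> cC ha hb' hab.
have E u v : (u + c) * (v + c) * (u + c) = u * v * u +
    (c * (u * v + v * u) + c * (u * u + c * u) + c * c * (u + v) + c * c * c).
  have cA y z : y * (c * z) = c * (y * z) by rewrite mulrA -cC mulrA.
  rewrite !(mulrDl, mulrDr) -!mulrA -?(cC u) -?(cC v) -?(cC (v * c)) ?cA -?(cC u) -?(cC v).
  by rewrite !addrA [LHS](ACl (1*5*3*2*4*6*7*8)).
by rewrite !E ha hb' hab [b * a + _]addrC [b + a]addrC.
Qed.

Theorem theorem5p2 (H : algType rat) (n k : nat)
  (p q hb : H) (T x : nat -> H) (cinv : H)
  (Hkn : (k <= n)%N)
  (Hpc : forall y : H, p * y = y * p)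
  (Hqc : forall y : H, q * y = y * q)
  (Hhc : forall y : H, hb * y = y * hb)
  (Hquad : forall i, (1 <= i < n)%N -> (T i + p) * (T i - q) = 0)
  (Hbraid : forall i, (1 <= i)%N -> (i.+1 < n)%N ->
              T i * T i.+1 * T i = T i.+1 * T i * T i.+1)
  (Hfar : forall i j, (1 <= i < n)%N -> (1 <= j < n)%N -> (i.+1 < j)%N ->
              T i * T j = T j * T i)
  (Hxx : forall i j, (1 <= i <= n)%N -> (1 <= j <= n)%N -> x i * x j = x j * x i)
  (HTx : forall i j, (1 <= i < n)%N -> (1 <= j <= n)%N -> j != i -> j != i.+1 ->
              T i * x j = x j * T i)
  (HTxi : forall i, (1 <= i < n)%N ->
              T i * x i = x i.+1 * T i + (hb - (p - q) * x i))
  (HTxi1 : forall i, (1 <= i < n)%N ->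
              T i * x i.+1 = x i * T i - (hb - (p - q) * x i))
  (Hcinv : cinv * (qfact p q k * qfact p q (n - k)) = 1)
  (Hcinv' : (qfact p q k * qfact p q (n - k)) * cinv = 1)
  (mu : seq nat) (Hmu : in_box n k mu) (r : nat) (Hr : (r <= k)%N) :
  Tnu p q T cinv n k mu * elem_sym x k r =
  \sum_(s <- incr_choose (iota 1 k) r)
     evalc p q T cinv n k (foldr (Dop p q n k hb x) [:: (1, mu)] s).
Proof.
pose c := p - q; pose t := Tbar p q T.
have cC y : c * y = y * c by rewrite mulrBl mulrBr Hpc Hqc.
have tcomm y i : y * T i = T i * y -> y * t i = t i * y.
  by move=> h; rewrite mulrDr mulrDl h cC.
have TT i : (1 <= i < n)%N -> T i * T i + c * T i = p * q.
  move=> /Hquad; rewrite mulrDl !mulrBr -(Hqc (T i)) addrA => /eqP; rewrite subr_eq0 => /eqP <-.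
  by rewrite /c mulrBl [p * T i - _]addrC addrA.
have tquad i : (1 <= i < n)%N -> t i * t i = (p - q) * t i + p * q.
  move=> hi; rewrite -(@TT i hi) /t /Tbar -/c mulrDl [c * (T i + c)]mulrDr mulrDr -(cC (T i)).
  by rewrite addrC.
have tbraid i : (1 <= i)%N -> (i.+1 < n)%N -> t i * t i.+1 * t i = t i.+1 * t i * t i.+1.
  move=> h1 h2; apply: (braid_shift (d := p * q) cC); last exact: Hbraid.
    by apply: TT; lia.
  by apply: TT; lia.
have tfar i j : (1 <= i)%N -> (j < n)%N -> (i.+1 < j)%N -> t i * t j = t j * t i.
  by move=> h1 h2 h3; apply/tcomm/esym/tcomm/esym/Hfar; lia.
have tx i j : (1 <= i < n)%N -> (1 <= j <= n)%N -> j != i -> j != i.+1 -> t i * x j = x j * t i.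
  by move=> h1 h2 h3 h4; apply/esym/tcomm/esym/HTx.
(* Passing from T_i to t_i replaces x_i by x_(i+1) in the correction term. *)
have txi i : (1 <= i < n)%N -> t i * x i = x i.+1 * t i + (hb - (p - q) * x i.+1).
  move=> hi; rewrite /t /Tbar mulrDl HTxi // -addrA subrK mulrDr -/c -cC -addrA.
  by rewrite [c * _ + _]addrC subrK.
(* For l > k, t_l commutes with each variable; for l < k it commutes with x_l + x_(l+1) and x_l
   x_(l+1). *)
have tes l : (1 <= l < n)%N -> l != k -> t l * elem_sym x k r = elem_sym x k r * t l.
  move=> hl hlk; rewrite -[elem_sym x k r]/(elsym x (iota 1 k) r).
  have [hlt|hge] := ltnP l k; last first.
    by apply: elsym_comm => i; rewrite mem_iota => hi; apply: tx; lia.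
  rewrite (@iota1_split l k); last by lia.
  apply: elsym_comm2.
  - by move=> i; rewrite mem_cat !mem_iota => hi; apply: tx; lia.
  - apply/esym/tcomm; rewrite mulrDr mulrDl HTxi // HTxi1 //.
    by rewrite addrACA subrr addr0 addrC.
  - apply/esym/tcomm; rewrite mulrA HTxi // mulrDl -[x l.+1 * _ * _]mulrA HTxi1 // mulrBr.
    have -> : (hb - (p - q) * x l) * x l.+1 = x l.+1 * (hb - (p - q) * x l).
      rewrite mulrBl mulrBr Hhc -mulrA (Hxx l l.+1); [|lia|lia].
      by rewrite !mulrA cC.
    by rewrite subrK mulrA (Hxx l l.+1) //; lia.
have SE : Sigma p q T cinv n k = cinv * symz n k q t.
  by rewrite /Sigma /symz big_allpairs_dep.
(* The quantum factorials are polynomials in the central p and q, so their inverse is central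
   too. *)
have QC y : qfact p q k * qfact p q (n - k) * y = y * (qfact p q k * qfact p q (n - k)).
  have qi m : GRing.comm y (qint p q m).
    by apply: commr_sum => j _; apply: commrM; apply/commr_sym; [apply: pXC|apply: qXC].
  by apply/commr_sym/commrM; apply: commr_prod => j _; apply: qi.
have cinvC y : cinv * y = y * cinv.
  by rewrite -[y in LHS]mulr1 -Hcinv' [y * _]mulrA -QC -[_ * y * cinv]mulrA mulrA Hcinv mul1r.
have tS l : (1 <= l < n)%N -> l != k -> t l * Sigma p q T cinv n k = p * Sigma p q T cinv n k.
  move=> hl hlk; rewrite SE mulrA -cinvC -mulrA (t_symz Hkn Hpc Hqc tquad tbraid tfar) //.
  by rewrite !mulrA cinvC.
have Se : Sigma p q T cinv n k * elem_sym x k r = elem_sym x k r * Sigma p q T cinv n k.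
  rewrite SE -mulrA -(symz_comm Hkn Hqc); first by rewrite mulrA cinvC mulrA.
  by move=> l hl hlk; rewrite tes.
have tw_mu la : in_box n k la -> Tbw p q T (wnu n k la) = rows t 0 la.
  exact: prod_red_wnu.
rewrite /Tnu -mulrA Se tw_mu //.
(* The substitution of k+1-i for i reverses 1, ..., k, which puts the monomials in the order in
   which [foldr_Dop] inserts the variables. *)
have -> : elem_sym x k r = \sum_(s <- incr_choose (iota 1 k) r) \prod_(i <- rev s) x (k.+1 - i)%N.
  rewrite -(elsym_rev (fun i => x (k.+1 - i)%N)).
  rewrite -[RHS](elsym_map x (fun i => k.+1 - i)%N) [elem_sym x k r]/(elsym x (iota 1 k) r).
  congr elsym; apply: (eq_from_nth (x0 := 0%N)); rewrite ?size_map ?size_rev ?size_iota // => i hi.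
  rewrite (nth_map 0%N) ?size_rev ?size_iota // nth_rev ?size_iota // !nth_iota; lia.
rewrite mulr_suml mulr_sumr; apply: eq_big_seq => s hs.
have ss := incr_choose_subseq hs.
have sk : all (fun i => i <= k)%N s.
  by apply/allP => i /(mem_subseq ss); rewrite mem_iota; lia.
(* With starting index 0 the letters to be absorbed are exactly those allowed by [tS], all l
   different from k. *)
rewrite -(@foldr_Dop H n k p q hb t x _ _ _ _ _ _ _ _ mu s 0) //; last first.
- by move=> l hl; apply: tS; lia.
- by apply: (subseq_path _ ss); [exact: ltn_trans|exact: (iota_ltn_sorted 0 k.+1)].
rewrite /evalc; apply: eq_big_seq => gm hgm; rewrite /Tnu tw_mu //.
exact: allP (foldr_Dop_in_box p q hb x s Hmu) _ hgm.
Qed.
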